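(* Let $n\ge2$. Every cobounded quasi-parabolic action of $F_n$ on a simplicial tree corresponds to a lamplike hyperbolic structure, and is represented by (i.e. is equivalent to) the action on the Bass–Serre tree of a strictly ascending HNN-extension expression of $F_n$.
   Context: **Hyperbolic structures.** Actions are by isometries. For cobounded actions of $G$ on Gromov hyperbolic (geodesic) spaces, write $G\curvearrowright X\preceq G\curvearrowright Y$ if there is a map $f\colon Y\to X$ that is coarsely Lipschitz and coarsely $G$-equivariant (for every $y$, $\sup_{g\in G}d(f(gy),gf(y))<\infty$). Two actions are equivalent if they dominate each other; $\mathcal{H}(G)$ is the poset of equivalence classes. An action on a hyperbolic space is quasi-parabolic if its limit set in $\partial X$ is infinite and $G$ fixes a point of $\partial X$. **The groups.** $F_n$ is the group of all piecewise linear orientation preserving homeomorphisms of $[0,1]$ with all slopes powers of $n$ and breakpoints in $\mathbb{Z}[1/n]$, acting on the right ($x.(gh)=(x.g).h$); $F_n'$ is its commutator subgroup; $\chi_0(g)=\log_n g'(0)$, $\chi_1(g)=\log_n g'(1)$. Conjugation is $x^y=y^{-1}xy$. Fix elements $a_0,\dots,a_{n-1}\in F_n$ such that $a_i$ has support a single open interval $(\ell_i,r_i)$, $\ell_0=0$, $\chi_0(a_0)=1$, $r_{n-1}=1$, $\chi_1(a_{n-1})=1$, $r_{i-1}<\ell_i$ for $1\le i\le n-1$, and the $a_i$ generate the abelianization $F_n/F_n'\cong\mathbb{Z}^n$ (such elements exist). They commute, so $F_n=F_n'\rtimes\mathbb{Z}^n$ with $\mathbb{Z}^n=\langle a_0,\dots,a_{n-1}\rangle$.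 Put $r=r_0$, $\chi=\chi_0$. **Confining subsets.** $Q\subseteq F_n'$ is $\chi$-confining if $Q=Q^{-1}$ and: $Q^z\subseteq Q$ for all $z\in\mathbb{Z}^n$ with $\chi(z)\ge0$; for every $h\in F_n'$ there is $z\in\mathbb{Z}^n$ with $h^z\in Q$; and there is $z_0\in\mathbb{Z}^n$ with $(Q\cdot Q)^{z_0}\subseteq Q$. It is strictly $\chi$-confining if moreover $Q^z\subsetneq Q$ for some $z\in\mathbb{Z}^n$. Let $Z_\chi=\{z\in\mathbb{Z}^n:|\chi(z)|\le1\}$. **Lamplike hyperbolic structures.** A hyperbolic structure on $F_n$ is lamplike (with respect to $\chi_0$) if it equals $[F_n\curvearrowright\mathrm{Cay}(F_n,Q\cup Z_\chi)]$ for some strictly $\chi$-confining $Q$ all of whose elements fix a common point $t\in(0,r)$. By the symmetry of the situation, a hyperbolic structure is also called lamplike if it is obtained from one of these by precomposing the action with the automorphism of $F_n$ given by conjugation by $x\mapsto1-x$ (which swaps $\chi_0$ and $\chi_1$). **HNN-extensions.** A strictly ascending HNN-extension expression of $G$ consists of a base $K\le G$ and a stable letter $s\in G$ of infinite order with $s^{-1}Ks\lneq K$, $G=\langle K,s\rangle$ and $\langle s\rangle\cap K=\{1\}$. Its Bass–Serre tree has vertex set $G/K$, with $gK$ joined to $gsK$ for each $g\in G$. *)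

(* Defs.v *)
From HB Require Import structures.
From mathcomp Require Import all_boot all_order all_algebra.
From mathcomp Require Import all_classical all_reals all_analysis.
From mathcomp Require Import lra ring.

Set Implicit Arguments.
Unset Strict Implicit.
Unset Printing Implicit Defensive.

Import Order.TTheory GRing.Theory Num.Theory.
Import numFieldNormedType.Exports.

Local Open Scope classical_set_scope.
Local Open Scope ring_scope.

Definition is_subgroup (G : groupType) (H : set G) : Prop :=
  [/\ H 1%g, (forall x y, H x -> H y -> H (x * y)%g) &
      (forall x, H x -> H (x^-1)%g)].

Definition generated (G : groupType) (S : set G) : set G :=
  [set x | forall H : set G, is_subgroup H -> S `<=` H -> H x].

Definition commutator_subgroup (G : groupType) : set G :=
  generated [set x | exists y z : G, x = [~ y, z]%g].

(* No metric or action axiom is imposed here: the spaces below are geometric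
   realizations of connected graphs, with group actions induced by actions by
   graph automorphisms. *)
Record gspace (R : realType) (G : groupType) := GSpace {
  point :> Type;
  dist : point -> point -> R;
  act : G -> point -> point }.

Definition twist (R : realType) (G : groupType) (phi : G -> G)
    (X : gspace R G) : gspace R G :=
  GSpace (@dist R G X) (fun g => act (phi g)).

Section Coarse.
Variables (R : realType) (G : groupType).
Implicit Types X Y : gspace R G.

Definition coarsely_lipschitz X Y (f : Y -> X) : Prop :=
  exists A B : R, forall y z : Y, dist (f y) (f z) <= A * dist y z + B.

Definition coarsely_equivariant X Y (f : Y -> X) : Prop :=
  forall y : Y, exists C : R, forall g : G,
    dist (f (act g y)) (act g (f y)) <= C.

Definition dominated X Y : Prop :=
  exists f : Y -> X, coarsely_lipschitz f /\ coarsely_equivariant f.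

Definition equivalent_actions X Y : Prop := dominated X Y /\ dominated Y X.

Definition cobounded X : Prop :=
  exists (x0 : X) (C : R), forall x : X, exists g : G, dist x (act g x0) <= C.

Definition gromov_product X (o x y : X) : R :=
  (dist x o + dist y o - dist x y) / 2.

Definition product_diverges X (s t : nat -> X) : Prop :=
  forall (o : X) (M : R), exists N : nat, forall i j : nat,
    (N <= i)%N -> (N <= j)%N -> M <= gromov_product o (s i) (t j).

Definition converges_at_infinity X (s : nat -> X) : Prop :=
  product_diverges s s.

(* The sequential boundary and limit set, meant for Gromov hyperbolic spaces:
   a boundary point is an equivalence class of sequences converging at infinity. *)
Definition boundary X : set (set (nat -> X)) :=
  [set [set t | converges_at_infinity t /\ product_diverges s t] |
     s in [set s | @converges_at_infinity X s]].

Definition limit_set X : set (set (nat -> X)) :=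
  [set xi | @boundary X xi /\
     exists (x : X) (g : nat -> G), xi (fun i => act (g i) x)].

Definition quasi_parabolic X : Prop :=
  infinite_set (@limit_set X) /\
  exists2 xi, @boundary X xi &
    forall g : G, [set (fun i => act g (s i)) | s in xi] = xi.

End Coarse.

Record ggraph (G : groupType) := GGraph {
  vertex :> choiceType;
  adj : rel vertex;
  adj_irr : irreflexive adj;
  adj_sym : symmetric adj;
  vact : G -> vertex -> vertex;
  vact1 : forall v, vact 1%g v = v;
  vactM : forall g h v, vact (g * h)%g v = vact g (vact h v);
  vact_adj : forall g u v, adj (vact g u) (vact g v) = adj u v }.

Definition is_tree (G : groupType) (T : ggraph G) : Prop :=
  (forall u v : T, exists2 p : seq T, path (@adj G T) u p & last u p = v) /\
  (forall c : seq T, ucycle (@adj G T) c -> (size c <= 2)%N).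

Section Realization.
Variables (R : realType) (G : groupType) (T : ggraph G).

(* Meaningful for connected graphs. *)
Definition path_dist (u v : T) : R :=
  inf [set ((size p)%:R : R) |
         p in [set p | path (@adj G T) u p /\ last u p = v]].

(* Points of the geometric realization, in barycentric coordinates. *)
Definition is_rpoint (p : T -> R) : Prop :=
  exists (u v : T) (t : R), [/\ (u == v) || adj u v, 0 <= t <= 1 &
    p = fun w => (1 - t) * (w == u)%:R + t * (w == v)%:R].

Definition rpoint : Type := {p : T -> R | is_rpoint p}.

Definition on_edge (p : rpoint) (u v : T) : Prop :=
  adj u v /\ sval p u + sval p v = 1.

(* Every edge has length 1. The infimum runs over the segment inside a common
   edge, if there is one, and over the paths from p to q leaving p through an
   end u of its edge and reaching q through an end v of its edge; p lies at
   distance 1 - p(u) from u. *)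
Definition rdist (p q : rpoint) : R :=
  inf ([set x | exists u v, [/\ on_edge p u v, on_edge q u v &
                                x = `|sval p u - sval q u|]] `|`
       [set x | exists u v, [/\ 0 < sval p u, 0 < sval q v &
                x = (1 - sval p u) + path_dist u v + (1 - sval q v)]]).

Lemma ract_subproof (g : G) (p : rpoint) :
  is_rpoint (fun w => sval p (vact (g^-1)%g w)).
Proof.
case: (svalP p) => u [v] [t] [uv t01 pE].
have K (x w : T) : (vact (g^-1)%g w == x) = (w == vact g x).
  by apply/eqP/eqP => [<-|->]; rewrite -vactM ?mulgV ?mulVg vact1.
exists (vact g u), (vact g v), t; split => //.
- by case/orP: uv => [/eqP ->|uv]; rewrite ?eqxx // vact_adj uv orbT.
- by apply/funext => w; rewrite pE !K.
Qed.

Definition ract (g : G) (p : rpoint) : rpoint := exist _ _ (ract_subproof g p).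

Definition realization : gspace R G := GSpace rdist ract.

End Realization.

Section CayleyGraph.
Variables (G : groupType) (S : set G).

Definition cayley_adj : rel G :=
  fun x y => (x != y) && `[< S (x^-1 * y)%g \/ S (y^-1 * x)%g >].

Lemma cayley_adj_irr : irreflexive cayley_adj.
Proof. by move=> x; rewrite /cayley_adj eqxx. Qed.

Lemma cayley_adj_sym : symmetric cayley_adj.
Proof.
move=> x y; rewrite /cayley_adj eq_sym; congr (_ && _).
by apply/asboolP/asboolP => -[]; [right|left|right|left].
Qed.

Lemma cayley_adj_act (g x y : G) :
  cayley_adj (g * x)%g (g * y)%g = cayley_adj x y.
Proof.
by rewrite /cayley_adj (inj_eq (mulgI g)) !invgM -!mulgA !mulKg.
Qed.

Definition cayley_graph : ggraph G :=
  GGraph cayley_adj_irr cayley_adj_sym (@mul1g G)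
    (fun g h x => esym (mulgA g h x)) cayley_adj_act.

End CayleyGraph.

Definition strictly_ascending_hnn (G : groupType) (K : set G) (s : G) : Prop :=
  [/\ is_subgroup K,
      (forall k : nat, (0 < k)%N -> (s ^+ k)%g <> 1%g),
      [set (k ^ s)%g | k in K] `<` K,
      generated (K `|` [set s]) = [set: G] &
      generated [set s] `&` K = [set 1%g]].

Section BassSerre.
Variables (G : groupType) (K : set G) (s : G).

Definition coset (g : G) : set G := [set (g * k)%g | k in K].

Definition cosets : Type := {C : set G | C \in range coset}.

Definition bs_edge (C D : cosets) : Prop :=
  exists g, sval C = coset g /\ sval D = coset (g * s)%g.

Definition bs_adj : rel cosets :=
  fun C D => (C != D) && `[< bs_edge C D \/ bs_edge D C >].

Lemma bs_adj_irr : irreflexive bs_adj.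
Proof. by move=> x; rewrite /bs_adj eqxx. Qed.

Lemma bs_adj_sym : symmetric bs_adj.
Proof.
move=> x y; rewrite /bs_adj eq_sym; congr (_ && _).
by apply/asboolP/asboolP => -[]; [right|left|right|left].
Qed.

Lemma image_coset (g h : G) :
  [set (g * x)%g | x in coset h] = coset (g * h)%g.
Proof.
apply/seteqP; split => [_ [_ [k Kk <-] <-]|_ [k Kk <-]].
  by exists k => //; rewrite mulgA.
by exists (h * k)%g; [exists k|rewrite mulgA].
Qed.

Lemma bs_act_subproof (g : G) (C : cosets) :
  [set (g * x)%g | x in sval C] \in range coset.
Proof.
case: C => C /= /set_mem[h _ <-]; rewrite image_coset.
by apply/mem_set; exists (g * h)%g.
Qed.

Definition bs_act (g : G) (C : cosets) : cosets :=
  exist (fun D => D \in range coset) _ (bs_act_subproof g C).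

Lemma bs_act1 (C : cosets) : bs_act 1%g C = C.
Proof.
apply: val_inj => /=; rewrite -[RHS]image_id.
by apply: eq_imagel => x _; rewrite mul1g.
Qed.

Lemma bs_actM (g h : G) (C : cosets) :
  bs_act (g * h)%g C = bs_act g (bs_act h C).
Proof.
apply: val_inj => /=; rewrite [RHS]image_comp.
by apply: eq_imagel => x _ /=; rewrite mulgA.
Qed.

Lemma bs_edge_act (g : G) (C D : cosets) :
  bs_edge C D -> bs_edge (bs_act g C) (bs_act g D).
Proof.
move=> [h [hC hD]]; exists (g * h)%g => /=.
by rewrite hC hD !image_coset mulgA.
Qed.

Lemma bs_adj_act (g : G) (C D : cosets) :
  bs_adj (bs_act g C) (bs_act g D) = bs_adj C D.
Proof.
have actK h : cancel (bs_act h) (bs_act h^-1%g).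
  by move=> E; rewrite -bs_actM mulVg bs_act1.
have edgeE E F : bs_edge (bs_act g E) (bs_act g F) <-> bs_edge E F.
  split; last exact: bs_edge_act.
  by move=> /(bs_edge_act g^-1%g); rewrite !actK.
rewrite /bs_adj (inj_eq (can_inj (actK g))); congr (_ && _).
by apply/asboolP/asboolP; rewrite !edgeE.
Qed.

Definition bass_serre_tree : ggraph G :=
  GGraph bs_adj_irr bs_adj_sym bs_act1 bs_actM bs_adj_act.

End BassSerre.

Section FnGroup.
Variables (R : realType) (n : nat).

Definition nadic (x : R) : Prop :=
  exists (m : int) (k : nat), x = m%:~R / n%:R ^+ k.

Definition piecewise_linear (f : R -> R) : Prop :=
  exists2 B : seq R, (forall b, b \in B -> nadic b) &
    forall a b : R, 0 <= a -> a < b -> b <= 1 ->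
      (forall c, c \in B -> ~~ (a < c < b)) ->
      exists k : int, forall x : R, a <= x <= b ->
        f x = f a + n%:R ^ k * (x - a).

(* A homeomorphism of [0,1] is represented by its extension by the identity to
   the whole line; an increasing surjection of the line is automatically a
   homeomorphism. *)
Definition is_Fn (f : R -> R) : Prop :=
  [/\ {homo f : x y / x < y}, (forall y : R, exists x : R, f x = y),
      (forall x : R, ~~ (0 <= x <= 1) -> f x = x) & piecewise_linear f].

End FnGroup.

Section FnClosure.
Variables (R : realType) (n : nat).
Implicit Types f g : R -> R.

Lemma nadicD (x y : R) : nadic n x -> nadic n y -> nadic n (x + y).
Proof.
have [n0|n0] := eqVneq (n%:R : R) 0.
  have nE (z : R) : nadic n z <-> exists m : int, z = m%:~R.
    split=> [[m [[|k] ->]]|[m ->]]; last by exists m, 0%N; rewrite expr0 divr1.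
      by exists m; rewrite expr0 divr1.
    by exists 0; rewrite n0 expr0n /= invr0 mulr0.
  rewrite !nE => -[m ->] [m' ->]; exists (m + m'); by rewrite intrD.
move=> [m [k ->]] [m' [k' ->]].
exists (m * (n ^ k')%:Z + m' * (n ^ k)%:Z), (k + k')%N.
rewrite intrD !intrM -!pmulrn !natrX exprD.
have ? : (n%:R : R) ^+ k != 0 by rewrite expf_neq0.
have ? : (n%:R : R) ^+ k' != 0 by rewrite expf_neq0.
by field; apply/andP.
Qed.

Lemma nadicN (x : R) : nadic n x -> nadic n (- x).
Proof. by move=> [m [k ->]]; exists (- m), k; rewrite intrN mulNr. Qed.

Lemma nadicZ (x : R) (k : int) : nadic n x -> nadic n (n%:R ^ k * x).
Proof.
move=> [m [j ->]]; case: k => k.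
  exists ((n ^ k)%:Z * m), j.
  by rewrite intrM -pmulrn natrX -exprnP mulrA.
by exists m, (k.+1 + j)%N; rewrite NegzE -exprnN exprD invfM mulrCA.
Qed.

Lemma nadic0 : nadic n (0 : R).
Proof. by exists 0, 0%N; rewrite mul0r. Qed.

Lemma nadic1 : nadic n (1 : R).
Proof. by exists 1, 0%N; rewrite expr0 divr1. Qed.

Lemma Fn_le f : is_Fn n f -> {mono f : x y / x <= y}.
Proof. by case=> /le_mono. Qed.

Lemma Fn_fix0 f : is_Fn n f -> f 0 = 0.
Proof.
move=> Ff; have [fh fs fid _] := Ff; have fm := Fn_le Ff.
case: (ltrgtP (f 0) 0) => // f0.
- have fE : f (f 0) = f 0 by apply: fid; lra.
  have := fm 0 (f 0); rewrite fE lexx; lra.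
- have [x xE] := fs 0.
  case: (lerP 0 x) => x0.
    have := fm 0 x; rewrite xE x0; lra.
  have := fid x; rewrite xE => H; have := H ltac:(lra); lra.
Qed.

Lemma Fn_fix1 f : is_Fn n f -> f 1 = 1.
Proof.
move=> Ff; have [fh fs fid _] := Ff; have fm := Fn_le Ff.
case: (ltrgtP (f 1) 1) => // f1.
- have [x xE] := fs 1.
  case: (lerP x 1) => x0.
    have := fm x 1; rewrite xE x0; lra.
  have := fid x; rewrite xE => H; have := H ltac:(lra); lra.
- have fE : f (f 1) = f 1 by apply: fid; lra.
  have := fm (f 1) 1; rewrite fE lexx; lra.
Qed.

Lemma last_before (B : seq R) (x : R) : 0 < x ->
  exists d, [/\ 0 <= d, d < x, d = 0 \/ d \in B &
               forall c, c \in B -> ~~ (d < c < x)].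
Proof.
move=> x0; elim: B => [|b B [d [d0 dx dB sep]]].
  by exists 0; split=> //; left.
case: (boolP (d < b < x)) => [/andP[db bx]|bN].
  exists b; split=> //.
  - by rewrite (le_trans d0) // ltW.
  - by right; rewrite mem_head.
  - move=> c; rewrite inE => /predU1P[->|/sep]; first by rewrite ltxx.
    by apply: contra => /andP[bc ->]; rewrite (lt_trans db).
exists d; split=> //.
- by case: dB => dB; [left|right; rewrite inE dB orbT].
- by move=> c; rewrite inE => /predU1P[->|/sep].
Qed.

Lemma count_lt (B : seq R) (d x : R) : d \in B -> d < x ->
  (count (fun c : R => (c < d)%R) B < count (fun c : R => (c < x)%R) B)%N.
Proof.
move=> dB dx; elim: B dB => // b B IH.
have le : (count (fun c : R => (c < d)%R) B <= count (fun c : R => (c < x)%R) B)%N.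
  by apply: sub_count => c /= /lt_trans; apply.
rewrite inE => /predU1P[<-|/IH {}IH] /=.
  by rewrite ltxx dx add0n add1n ltnS.
have bb : (nat_of_bool (b < d)%R <= nat_of_bool (b < x)%R)%N.
  by case: (ltP b d) => // /lt_trans ->.
by rewrite -addnS leq_add.
Qed.

Lemma Fn_nadic f x : is_Fn n f -> 0 <= x <= 1 -> nadic n x -> nadic n (f x).
Proof.
move=> Ff; have [_ _ _ [B Bn Bf]] := Ff.
elim: {x}_.+1 {-2}x (ltnSn (count (fun c : R => c < x) B)) => // m IH x.
rewrite ltnS => xm /andP[x0 x1] xn.
have [->|xn0] := eqVneq x 0; first by rewrite Fn_fix0 //; exact: nadic0.
have {xn0}xp : 0 < x by rewrite lt_def xn0.
have [d [d0 dx dB dsep]] := last_before B xp.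
have dn : nadic n d by case: dB => [->|/Bn //]; exact: nadic0.
have fdn : nadic n (f d).
  case: dB => [->|dB]; first by rewrite Fn_fix0 //; exact: nadic0.
  apply: IH => //; last by rewrite d0 (le_trans (ltW dx)).
  apply: leq_trans xm; apply: count_lt dB dx.
have [k fE] := Bf d x d0 dx x1 dsep.
rewrite fE ?(ltW dx) ?lexx //; apply: nadicD => //.
by apply: nadicZ; apply: nadicD => //; apply: nadicN.
Qed.

Lemma Fn_id : is_Fn n (id : R -> R).
Proof.
split=> //; first by move=> y; exists y.
exists [::] => // a b _ _ _ _; exists 0 => x _.
by rewrite expr0z mul1r addrC subrK.
Qed.

Definition ginv f : R -> R := fun y => xget 0 [set x | f x = y].

Lemma ginvK f : is_Fn n f -> cancel (ginv f) f.
Proof.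
by move=> [_ fs _ _] y; have [x xE] := fs y; rewrite /ginv; case: xgetP => // /(_ x).
Qed.

Lemma Fn_inj f : is_Fn n f -> injective f.
Proof. by move=> /Fn_le/inc_inj. Qed.

Lemma fnK f : is_Fn n f -> cancel f (ginv f).
Proof. by move=> Ff x; apply: (Fn_inj Ff); rewrite ginvK. Qed.

Lemma Fn_itv f x : is_Fn n f -> (0 <= f x <= 1) = (0 <= x <= 1).
Proof.
by move=> Ff; rewrite -{1}(Fn_fix0 Ff) -{1}(Fn_fix1 Ff) !(Fn_le Ff).
Qed.

Lemma ginv_Fn f : is_Fn n f -> is_Fn n (ginv f).
Proof.
move=> Ff; have [fh fs fid [B Bn Bf]] := Ff.
have gK := ginvK Ff; have fK := fnK Ff; have fm := Fn_le Ff.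
have fl := leW_mono fm.
split.
- by move=> x y xy; rewrite -fl !gK.
- by move=> y; exists (f y).
- by move=> x x01; rewrite -{1}(fid x x01) fK.
exists [seq f b | b <- B & 0 <= b <= 1].
  move=> _ /mapP[b + ->]; rewrite mem_filter => /andP[b01 bB].
  by apply: Fn_nadic => //; exact: Bn.
move=> a b a0 ab b1 sep.
pose a' := ginv f a; pose b' := ginv f b.
have a'0 : 0 <= a' by rewrite -fm gK (Fn_fix0 Ff).
have b'1 : b' <= 1 by rewrite -fm gK (Fn_fix1 Ff).
have a'b' : a' < b' by rewrite -fl !gK.
have [|k kE] := Bf a' b' a'0 a'b' b'1.
  move=> c cB; apply/negP => /andP[ac cb].
  have : f c \in [seq f b | b <- B & 0 <= b <= 1].
    by apply: map_f; rewrite mem_filter cB andbT; lra.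
  by move=> /sep; rewrite -[a]gK -[b]gK !fl -/a' -/b' ac cb.
have nk0 : (n%:R : R) ^ k != 0.
  apply/eqP => nk0; have := kE b'; rewrite nk0 mul0r addr0 lexx ltW // => H.
  by have := Fn_inj Ff (H isT) => ab'; rewrite ab' ltxx in a'b'.
exists (- k) => x /andP[ax xb].
have xE : f (ginv f x) = f a' + n%:R ^ k * (ginv f x - a').
  by apply: kE; rewrite -fm gK gK ax -fm gK gK xb.
have -> : x - a = n%:R ^ k * (ginv f x - a').
  by rewrite -{1}[x]gK xE gK addrAC subrr add0r.
by rewrite -invr_expz mulKf // addrC subrK.
Qed.

Lemma comp_Fn f g : is_Fn n f -> is_Fn n g -> is_Fn n (g \o f).
Proof.
move=> Ff Fg; have [fh fs fid [B Bn Bf]] := Ff.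
have [gh gs gid [C Cn Cg]] := Fg.
have fl := leW_mono (Fn_le Ff).
split.
- by move=> x y /fh/gh.
- by move=> z; have [y <-] := gs z; have [x <-] := fs y; exists x.
- by move=> x x01 /=; rewrite fid ?gid.
exists (B ++ [seq ginv f c | c <- C & 0 <= c <= 1]).
  move=> b; rewrite mem_cat => /orP[/Bn //|/mapP[c + ->]].
  rewrite mem_filter => /andP[c01 cC].
  by apply: Fn_nadic (ginv_Fn Ff) _ (Cn _ cC).
move=> a b a0 ab b1 sep.
have [|k kE] := Bf a b a0 ab b1.
  by move=> c cB; apply: sep; rewrite mem_cat cB.
have fa0 : 0 <= f a by rewrite -(Fn_fix0 Ff) (Fn_le Ff).
have fb1 : f b <= 1 by rewrite -(Fn_fix1 Ff) (Fn_le Ff).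
have [||j jE] := Cg (f a) (f b) fa0 _ fb1; first exact: fh.
  move=> c cC; apply/negP => /andP[ac cb].
  have : ginv f c \in B ++ [seq ginv f c | c <- C & 0 <= c <= 1].
    by rewrite mem_cat map_f ?orbT // mem_filter cC andbT; lra.
  by move=> /sep; rewrite -(fl a) -(fl _ b) (ginvK Ff) ac cb.
have nj0 : (n%:R : R) != 0 \/ (n%:R : R) = 0.
  by have [->|] := eqVneq (n%:R : R) 0; [right|left].
have fab x : a <= x <= b -> f a <= f x <= f b by rewrite !(Fn_le Ff).
case: nj0 => [n0|n0].
  exists (j + k) => x xab /=.
  rewrite jE ?fab // (kE x) // expfzDr //.
  by rewrite -mulrA [X in _ * X]addrAC subrr add0r.
have xab : a <= b <= b by rewrite lexx ltW.
have j0 : j = 0.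
  apply/eqP; apply: contraT => j0; have := jE _ (fab _ xab).
  rewrite n0 exp0rz (negPf j0) mul0r addr0 => /(Fn_inj Fg)/(Fn_inj Ff) ba.
  by rewrite ba ltxx in ab.
exists k => x {}xab /=.
by rewrite jE ?fab // j0 expr0z mul1r (kE x) // addrAC subrr add0r.
Qed.

Lemma flip_Fn f : is_Fn n f -> is_Fn n (fun x => 1 - f (1 - x)).
Proof.
move=> [fh fs fid [B Bn Bf]]; split.
- by move=> x y xy; rewrite ltrD2l ltrN2 fh // ltrD2l ltrN2.
- move=> y; have [x xE] := fs (1 - y); exists (1 - x).
  by rewrite !subKr xE subKr.
- by move=> x x01; rewrite fid ?subKr //; apply: contra x01; lra.
exists [seq 1 - b | b <- B].
  by move=> _ /mapP[b /Bn bn ->]; apply: nadicD (nadicN bn); exact: nadic1.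
move=> a b a0 ab b1 sep.
have [|||c cB|k kE] := Bf (1 - b) (1 - a); try lra.
  have /sep : 1 - c \in [seq 1 - b | b <- B] by exact: map_f.
  by apply: contra; lra.
exists k => x xab.
have -> : f (1 - x) = f (1 - b) + n%:R ^ k * (1 - x - (1 - b)).
  by apply: kE; lra.
have -> : f (1 - a) = f (1 - b) + n%:R ^ k * (1 - a - (1 - b)).
  by apply: kE; lra.
by ring.
Qed.

End FnClosure.

Record Fn (R : realType) (n : nat) := MkFn {
  fn_fun :> R -> R;
  fn_prop : is_Fn n fn_fun }.

Section FnGroupStructure.
Variables (R : realType) (n : nat).
Local Notation F := (Fn R n).

Lemma Fn_ext (f g : F) : (forall x, f x = g x) -> f = g.
Proof.
case: f g => [f Ff] [g Fg] /= /funext fg; move: Ff; rewrite fg => Ff.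
by congr MkFn; exact: Prop_irrelevance.
Qed.

HB.instance Definition _ := gen_eqMixin F.
HB.instance Definition _ := gen_choiceMixin F.

Definition Fn_one : F := MkFn (Fn_id R n).

Definition Fn_inv (f : F) : F := MkFn (ginv_Fn (fn_prop f)).

(* Elements act on the right: x.(fg) = (x.f).g *)
Definition Fn_mul (f g : F) : F := MkFn (comp_Fn (fn_prop f) (fn_prop g)).

Lemma Fn_mulA : associative Fn_mul.
Proof. by move=> f g h; exact: Fn_ext. Qed.

Lemma Fn_mul1 : left_id Fn_one Fn_mul.
Proof. by move=> f; exact: Fn_ext. Qed.

Lemma Fn_mulr1 : right_id Fn_one Fn_mul.
Proof. by move=> f; exact: Fn_ext. Qed.

Lemma Fn_mulV : left_inverse Fn_one Fn_inv Fn_mul.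
Proof. by move=> f; apply: Fn_ext => x /=; rewrite (ginvK (fn_prop f)). Qed.

Lemma Fn_mulrV : right_inverse Fn_one Fn_inv Fn_mul.
Proof. by move=> f; apply: Fn_ext => x /=; rewrite (fnK (fn_prop f)). Qed.

HB.instance Definition _ :=
  isGroup.Build F Fn_mulA Fn_mul1 Fn_mulr1 Fn_mulV Fn_mulrV.

Definition Fn_flip (f : F) : F := MkFn (flip_Fn (fn_prop f)).

(* Elements are extended by the identity outside [0,1], so the derivatives at
   0 and 1 have to be one-sided. *)
Definition chi0 (f : F) : R :=
  ln (lim ((f h - f 0) / h @[h --> 0^'+])) / ln n%:R.

Definition chi1 (f : F) : R :=
  ln (lim ((f (1 + h) - f 1) / h @[h --> 0^'-])) / ln n%:R.

End FnGroupStructure.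

Section Lamplike.
Variables (R : realType) (n : nat).
Local Notation F := (Fn R n).
Local Notation F' := (@commutator_subgroup F).

Definition Zn (a : nat -> F) : set F :=
  generated [set x | exists2 i, (i < n)%N & x = a i].

(* The values a i, l i and r i with i >= n are irrelevant. *)
Definition standard_elements (a : nat -> F) (l r : nat -> R) : Prop :=
  [/\ (forall i, (i < n)%N ->
         l i < r i /\ [set x | a i x != x] = [set x | l i < x < r i]),
      l 0%N = 0 /\ chi0 (a 0%N) = 1,
      r n.-1 = 1 /\ chi1 (a n.-1) = 1,
      (forall i, (0 < i < n)%N -> r i.-1 < l i) &
      (forall g : F, exists2 z, Zn a z & F' (z^-1 * g)%g)].

Definition confining (a : nat -> F) (Q : set F) : Prop :=
  [/\ Q `<=` F', [set (q^-1)%g | q in Q] = Q,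
      (forall z, Zn a z -> 0 <= chi0 z -> [set (q ^ z)%g | q in Q] `<=` Q),
      (forall h, F' h -> exists2 z, Zn a z & Q (h ^ z)%g) &
      (exists2 z0, Zn a z0 & forall p q, Q p -> Q q -> Q ((p * q) ^ z0)%g)].

Definition strictly_confining (a : nat -> F) (Q : set F) : Prop :=
  confining a Q /\
  exists2 z, Zn a z & [set (q ^ z)%g | q in Q] `<` Q.

Definition Zchi (a : nat -> F) : set F :=
  [set z | Zn a z /\ `|chi0 z| <= 1].

Definition lamplike_model (a : nat -> F) (Q : set F) : gspace R F :=
  realization R (cayley_graph (Q `|` Zchi a)).

(* A hyperbolic structure is the class of an action under equivalent_actions:
   X represents a lamplike structure. The twisted alternative exchanges the
   roles of chi0 and chi1. *)
Definition lamplike (a : nat -> F) (r0 : R) (X : gspace R F) : Prop :=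
  exists Q : set F,
    [/\ strictly_confining a Q,
        (exists2 t : R, 0 < t < r0 & forall q, Q q -> q t = t) &
        equivalent_actions X (lamplike_model a Q) \/
        equivalent_actions X (twist (@Fn_flip R n) (lamplike_model a Q))].

End Lamplike.

(* Main.v *)
Require Import Defs.
From mathcomp Require Import all_boot all_order all_algebra.
From mathcomp Require Import all_classical all_reals all_analysis.
From mathcomp Require Import zify lra ring.

(** A tree with an end fixed by a group [G] is best seen from that end: every
    vertex [v] has a successor [up v] on the ray towards the end, the Busemann
    function [height] grows by 1 along [up], and every [g] changes heights by a
    constant [shift g], which is a homomorphism in [g] ([quasi_parabolic_fixed_end]).
    Elements of zero shift fix a ray towards the end. An element of positive
    shift has an axis, with one point at each height; elements commuting with it
    preserve its axis. An infinite limit set prevents any axis from being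
    invariant under [G] ([quasi_parabolic_no_axis]), and coboundedness makes the
    shift nonzero.

    The Bass-Serre tree ([quasi_parabolic_hnn], for any group). Let [s] have
    minimal positive shift and let [v] lie on its axis, with stabilizer [K]. As
    [s v] lies above [v], conjugation by [s] maps [K] into itself, properly since
    the axis is not invariant. Comparing [g v] with [v] at a height where their
    rays have merged writes [g] as [s^m k s^-m'] with [k] in [K] and [m + m']
    bounded linearly by the distance from [v] to [g v]. So [K] and [s] generate
    [G], and the orbit maps to the tree and to the Bass-Serre tree have
    comparable length functions, which is all that equivalence requires
    ([dominated_orbit]).

    The lamplike structure. In F_n, let [g] be trivial near 1 and [g'] trivial
    near 0. They cannot both have nonzero shift ([disjoint_supports_shift]):
    conjugating [g] by an [f] that pushes its support off that of [g'] gives an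
    element commuting with [g'], so the image of the axis of [g] is the axis of
    [g']; this holds for [f] as well as for [h f], for any [h] and suitable [f],
    so the axis of [g] would be invariant under all [h]. Hence the shift vanishes
    on the elements trivial near both ends, and is a multiple of chi0 or of chi1.
    Reflecting the interval ([twist_graph]), assume that it is a multiple of
    chi0, that is, nonzero on [a0]. Then [shift a0] is positive
    ([shift_a0_gt0]). Let [v] be on the axis of [a0] and let [Q] consist of
    the elements of the commutator subgroup that fix [v]. It is strictly
    confining for the same reasons that [K] is the base of an ascending
    HNN-extension, and its Cayley graph is compared with the tree in the same
    way ([lamplike_equivalent]).

    The point fixed by [Q] comes from one more use of supports. If [f] fixes a
    point [w] of the axis of [a0], and [h] has zero shift and commutes with
    [a0 ^ f], then [h] fixes the axis of [a0 ^ f], which contains [w]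
    ([fix_commute_conj]). The infimum [t] of the orbit of [r0] under [Q] is fixed
    by [Q]; were it 0, some [f] in [Q] would push the support of [a0] off that of
    any given [h] in the commutator subgroup, which would therefore fix [v], and
    then the axis would be invariant ([point_fixator_common_fix]). *)

Set Implicit Arguments.
Unset Strict Implicit.
Unset Printing Implicit Defensive.

Import Order.TTheory GRing.Theory Num.Theory.
Import numFieldNormedType.Exports.

Local Open Scope classical_set_scope.
Local Open Scope ring_scope.

(** * Distances in graphs and trees *)

Section GraphDistance.
Variables (G : groupType) (T : ggraph G).
Implicit Types (u v w x y : T) (g : G).

Definition walk u v (k : nat) : Prop :=
  exists p : seq T, [/\ path (@adj G T) u p, last u p = v & size p = k].

Definition gconnected : Prop := forall u v, exists k, walk u v k.

Lemma walk0 u : walk u u 0.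
Proof. by exists [::]. Qed.

Lemma walk1 u v : adj u v -> walk u v 1.
Proof. by move=> uv; exists [:: v]; rewrite /= uv. Qed.

Lemma walk_cat u v w k m : walk u v k -> walk v w m -> walk u w (k + m).
Proof.
move=> [p [pp <- <-]] [q [qp <- <-]]; exists (p ++ q).
by rewrite cat_path pp qp last_cat size_cat.
Qed.

Lemma walk_cons u v w k : adj u v -> walk v w k -> walk u w k.+1.
Proof. by move=> /walk1 uv vw; rewrite -add1n; apply: walk_cat uv vw. Qed.

Lemma walkS u w k : walk u w k.+1 -> exists2 v, adj u v & walk v w k.
Proof.
move=> [[|v p] [//= /andP[uv pp] pl [ps]]].
by exists v => //; exists p.
Qed.

Lemma walk_sym u v k : walk u v k -> walk v u k.
Proof.
elim: k u => [|k IH] u.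
  by move=> [[|? ?] [//= _ -> _]]; exact: walk0.
move=> /walkS[w uw /IH wu]; rewrite -addn1; apply: walk_cat wu _.
by apply: walk1; rewrite adj_sym.
Qed.

Lemma walk_act g u v k : walk u v k -> walk (vact g u) (vact g v) k.
Proof.
elim: k u => [|k IH] u.
  by move=> [[|? ?] [//= _ -> _]]; exact: walk0.
by move=> /walkS[w uw /IH]; apply: walk_cons; rewrite vact_adj.
Qed.

(** The value 0 in the absence of a path is a convention; the lemmas below
    assume the graph connected. *)
Definition gdist u v : nat :=
  if pselect (exists k, `[< walk u v k >]) is left e then ex_minn e else 0.

Lemma gdist_le u v k : walk u v k -> (gdist u v <= k)%N.
Proof.
move=> uv; rewrite /gdist; case: pselect => // e.
by case: ex_minnP => m _; apply; apply/asboolP.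
Qed.

Hypothesis conn : gconnected.

Lemma gdist_walk u v : walk u v (gdist u v).
Proof.
rewrite /gdist; case: pselect => [e|].
  by case: ex_minnP => m /asboolP.
by have [k uv] := conn u v; case; exists k; apply/asboolP.
Qed.

Lemma gdist0 u : gdist u u = 0.
Proof. by apply/eqP; rewrite -leqn0; apply/gdist_le/walk0. Qed.

Lemma gdist0_eq u v : gdist u v = 0 -> u = v.
Proof. by move=> uv; have := gdist_walk u v; rewrite uv => -[[|? ?] []]. Qed.

Lemma gdist_sym u v : gdist u v = gdist v u.
Proof.
by apply/eqP; rewrite eqn_leq !gdist_le //; apply/walk_sym/gdist_walk.
Qed.

Lemma gdist_triangle u v w : (gdist u w <= gdist u v + gdist v w)%N.
Proof. by apply: gdist_le; apply: walk_cat (gdist_walk _ _) (gdist_walk _ _). Qed.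

Lemma gdist_act g u v : gdist (vact g u) (vact g v) = gdist u v.
Proof.
apply/eqP; rewrite eqn_leq gdist_le; last exact/walk_act/gdist_walk.
have := walk_act g^-1%g (gdist_walk (vact g u) (vact g v)).
by rewrite -!vactM mulVg !vact1 => /gdist_le.
Qed.

Lemma gdist_adj u v x : adj u v -> (gdist u x <= (gdist v x).+1)%N.
Proof. by move=> uv; apply: gdist_le; apply: walk_cons uv (gdist_walk _ _). Qed.

Lemma gdist_step v x : v != x ->
  exists2 u, adj v u & gdist v x = (gdist u x).+1.
Proof.
move=> vx; case dE : (gdist v x) => [|k].
  by move/gdist0_eq: dE vx => ->; rewrite eqxx.
have := gdist_walk v x; rewrite dE => /walkS[u vu /gdist_le ux].
by exists u => //; have := gdist_adj x vu; lia.
Qed.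

Lemma path_distE (R : realType) u v : path_dist R u v = (gdist u v)%:R.
Proof.
rewrite /path_dist; set S := [set _ | _ in _].
have [p [pp pl ps]] := gdist_walk u v.
have SE : S (gdist u v)%:R by exists p => //; rewrite ps.
have lb : lbound S (gdist u v)%:R.
  move=> _ [q [qp ql] <-]; rewrite ler_nat; apply: gdist_le.
  by exists q.
apply/eqP; rewrite eq_le; apply/andP; split.
  by apply: ge_inf => //; exists (gdist u v)%:R.
by apply: lb_le_inf => //; exists (gdist u v)%:R.
Qed.

End GraphDistance.

Section Tree.
Variables (G : groupType) (T : ggraph G).
Implicit Types (u v w x y : T) (g : G).
Hypothesis treeT : is_tree T.

Lemma tree_connected : gconnected T.
Proof. by move=> u v; have [p pp pl] := treeT.1 u v; exists (size p), p. Qed.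
Let conn := tree_connected.

Definition linked_off v u w : Prop :=
  exists p : seq T, [/\ path (@adj G T) u p, last u p = w & v \notin u :: p].

Lemma linked_off_trans v x u w :
  linked_off v u x -> linked_off v x w -> linked_off v u w.
Proof.
move=> [p [pp pl vp]] [q [qp ql vq]]; exists (p ++ q).
rewrite cat_path last_cat pl pp qp ql; split => //.
by move: vp vq; rewrite !inE mem_cat !negb_or => /andP[-> ->] /andP[_ ->].
Qed.

Lemma linked_off_sym v u w : linked_off v u w -> linked_off v w u.
Proof.
move=> [p [pp pl vp]]; elim: p u pp pl vp => [|x p IH] u /=.
  by move=> _ <- uv; exists [::].
move=> /andP[ux xp] pl; rewrite inE negb_or => /andP[vu vp].
apply: linked_off_trans (IH _ xp pl vp) _.
exists [:: u]; rewrite /= andbT adj_sym ux; split => //.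
by rewrite !inE negb_or vu andbT; move: vp; rewrite inE negb_or => /andP[].
Qed.

(** Two neighbours of [v] that are linked off [v] would close a cycle through
    [v]; this is the only use of the absence of cycles. *)
Lemma neighbours_linked_off v u w :
  adj v u -> adj v w -> linked_off v u w -> u = w.
Proof.
move=> vu vw [p [pp pl vp]].
move: (vp); rewrite inE negb_or => /andP[v_u {}vp].
move: pl; case: (shortenP pp) => p' p'p p'u p's pl.
have p'v : v \notin p' by apply: contra vp; apply: p's.
have : ucycle (@adj G T) (v :: u :: p').
  rewrite /ucycle /= vu rcons_path p'p pl adj_sym vw /=.
  by move: p'u => /= ->; rewrite inE negb_or v_u p'v.
by move=> /(treeT.2) /=; case: p' pl {p'p p'u p's p'v} => /=.
Qed.

(** The vertices of a geodesic from [u] to [x] after [u] are strictly nearer to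
    [x] than [u], so [v] is not among them. *)
Lemma linked_off_nearer v u x :
  u != v -> (gdist u x <= gdist v x)%N -> linked_off v u x.
Proof.
move: {2}(gdist u x) (erefl (gdist u x)) => k.
elim: k u => [|k IH] u dE uv ux.
  exists [::]; rewrite (gdist0_eq conn dE) /=; split=> //.
  by rewrite inE eq_sym -(gdist0_eq conn dE).
have [|u' uu' uE] := @gdist_step _ _ conn u x.
  by apply: contra_eqN dE => /eqP ->; rewrite gdist0.
have u'E : gdist u' x = k by lia.
have u'v : u' != v by apply: contraTneq ux => <-; lia.
apply: linked_off_trans (IH u' u'E u'v _); last by lia.
exists [:: u']; rewrite /= uu'; split => //.
by rewrite !inE negb_or eq_sym uv eq_sym u'v.
Qed.

(** Geodesics from two such neighbours to [x] would avoid [v] and link them. *)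
Lemma nearer_neighbour_unique v u w x : adj v u -> adj v w ->
  (gdist u x <= gdist v x)%N -> (gdist w x <= gdist v x)%N -> u = w.
Proof.
have ne y : adj v y -> y != v.
  by apply: contraTneq => ->; rewrite adj_irr.
move=> vu vw ux wx; apply: (neighbours_linked_off vu vw).
apply: (@linked_off_trans _ x); first exact: linked_off_nearer (ne _ vu) ux.
by apply/linked_off_sym/linked_off_nearer; rewrite ?ne.
Qed.

(** A path from [x] to [y] avoiding [v] would link [u] and [w] off [v], hence
    every path from [x] to [y] passes through [v]. *)
Lemma gdist_branch v u w x y : adj v u -> adj v w -> u <> w ->
    (gdist u x < gdist v x)%N -> (gdist w y < gdist v y)%N ->
  gdist x y = (gdist v x + gdist v y)%N.
Proof.
have ne z : adj v z -> z != v by apply: contraTneq => ->; rewrite adj_irr.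
move=> vu vw uw ux wy.
suff : (gdist v x + gdist v y <= gdist x y)%N.
  by have := gdist_triangle conn x v y; rewrite (gdist_sym conn x v); lia.
have [p [pp pl <-]] := gdist_walk conn x y.
have [vp|vp] := boolP (v \in x :: p); last first.
  case: uw; apply: (neighbours_linked_off vu vw).
  apply: (@linked_off_trans _ x).
    by apply: linked_off_nearer; rewrite ?ne // ltnW.
  apply: (@linked_off_trans _ y); first by exists p.
  by apply/linked_off_sym/linked_off_nearer; rewrite ?ne // ltnW.
move: pp pl; case/splitPl: vp => p1 p2 p1l.
rewrite cat_path last_cat p1l size_cat => /andP[pp1 pp2] p2l.
apply: leq_add; last by apply: gdist_le; exists p2.
by rewrite gdist_sym //; apply: gdist_le; exists p1.
Qed.

(** A positive Gromov product at [o] forces geodesics from [o] to start with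
    the same edge. *)
Lemma common_first_step o x y : (gdist x y < gdist o x + gdist o y)%N ->
    o != x -> o != y ->
  exists u, [/\ adj o u, gdist o x = (gdist u x).+1 &
                gdist o y = (gdist u y).+1].
Proof.
move=> xy /(gdist_step conn)[u ou ux] /(gdist_step conn)[w ow wy].
exists u; split => //.
have [->//|/eqP uw] := eqVneq u w.
by move: xy; rewrite (gdist_branch ou ow uw) ?ltnn // ?ux ?wy.
Qed.

(** Trees are 0-hyperbolic. When the products at [o] are positive, the three
    geodesics from [o] start with the same edge, and moving [o] along it lowers
    the products by 1. *)
Lemma four_point m o x y z :
    (2 * m + gdist x y <= gdist o x + gdist o y)%N ->
    (2 * m + gdist y z <= gdist o y + gdist o z)%N ->
  (2 * m + gdist x z <= gdist o x + gdist o z)%N.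
Proof.
elim: m o => [|m IH] o xy yz.
  by have := gdist_triangle conn x o z; rewrite (gdist_sym conn x o).
have ne a b : (2 * m.+1 + gdist a b <= gdist o a + gdist o b)%N -> o != a.
  by apply: contraTneq => <-; rewrite gdist0; lia.
have ne' a b : (2 * m.+1 + gdist a b <= gdist o a + gdist o b)%N -> o != b.
  by apply: contraTneq => <-; rewrite gdist0 gdist_sym //; lia.
have [u [ou ux uy]] := @common_first_step o x y ltac:(lia) (ne _ _ xy) (ne' _ _ xy).
have [w [ow wy wz]] := @common_first_step o y z ltac:(lia) (ne _ _ yz) (ne' _ _ yz).
have uw : u = w by apply: (nearer_neighbour_unique ou ow (x := y)); lia.
by subst w; have := IH u; lia.
Qed.

End Tree.

(** * Realizations and coarse equivalence *)

Section Realization.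
Variables (R : realType) (G : groupType) (T : ggraph G).
Implicit Types (p q : rpoint R T) (u v w : T) (g : G).

Lemma rpoint_near p : exists u, 0 < sval p u.
Proof.
have [u [v [t [_ /andP[t0 t1] ->]]]] := svalP p.
have [t_1|t_1] := ltP t 1; last first.
  by exists v; rewrite eqxx mulr1; case: (v == u); rewrite /= ?mulr1 ?mulr0; lra.
by exists u; rewrite eqxx mulr1; case: (u == v); rewrite /= ?mulr1 ?mulr0; lra.
Qed.

(** Any vertex of positive weight will do: its distance to [p] is less than 1. *)
Definition near_vertex p : T := projT1 (cid (rpoint_near p)).

Lemma near_gt0 p : 0 < sval p (near_vertex p).
Proof. exact: (projT2 (cid (rpoint_near p))). Qed.

Lemma vertex_point_subproof v : is_rpoint (fun w => (w == v)%:R : R).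
Proof.
exists v, v, 0; rewrite eqxx lexx ler01; split => //.
by apply/funext => w; rewrite subr0 mul1r mul0r addr0.
Qed.

Definition vertex_point v : rpoint R T := exist _ _ (vertex_point_subproof v).

Lemma near_vertex_point v : near_vertex (vertex_point v) = v.
Proof.
have := near_gt0 (vertex_point v); rewrite /= ltr0n lt0b.
by move=> /eqP.
Qed.

Lemma rpoint_le1 p u : sval p u <= 1.
Proof.
have [x [y [t [_ /andP[t0 t1] ->]]]] := svalP p.
by case: (u == x); case: (u == y); rewrite /= ?mulr1 ?mulr0; lra.
Qed.

(** The barycentric coordinates of [p] sum to 1, so no vertex outside an edge
    containing [p] has a positive one. *)
Lemma on_edge_support p u a b : on_edge p a b -> 0 < sval p u -> u = a \/ u = b.
Proof.
move=> [ab]; have {}ab : a != b by apply: contraTneq ab => ->; rewrite adj_irr.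
have [x [y [t [_ /andP[t0 t1] ->]]]] := svalP p.
have [ua|ua] := eqVneq u a; first by left.
have [ub|ub] := eqVneq u b; first by right.
have one z : (u == z)%:R + ((a == z)%:R + (b == z)%:R) <= 1 :> R.
  have [uz|uz] := eqVneq u z.
    by rewrite -uz !(eq_sym _ u) (negPf ua) (negPf ub) !addr0.
  have [az|az] := eqVneq a z.
    by rewrite -az (eq_sym b) (negPf ab) addr0 add0r.
  by case: (b == z); rewrite /= !add0r.
have := one x; have := one y.
set a1 := (u == x)%:R; set a2 := (a == x)%:R; set a3 := (b == x)%:R.
set b1 := (u == y)%:R; set b2 := (a == y)%:R; set b3 := (b == y)%:R.
move=> h1 h2 h3 h4.
have t0' : 0 <= 1 - t by rewrite subr_ge0.
exfalso; have := ler_wpM2l t0 h1; have := ler_wpM2l t0' h2.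
by move: h3 h4; rewrite !mulr1 !mulrDr; lra.
Qed.

Lemma support_walk p u v : 0 < sval p u -> 0 < sval p v ->
  exists2 k, walk u v k & (k <= 1)%N.
Proof.
have [x [y [t [xy t01 ->]]]] := svalP p.
have sup w : 0 < (1 - t) * (w == x)%:R + t * (w == y)%:R :> R -> w = x \/ w = y.
  have [->|wx] := eqVneq w x; first by left.
  have [->|wy] := eqVneq w y; first by right.
  by rewrite !mulr0 addr0 ltxx.
have xyw : exists2 k, walk x y k & (k <= 1)%N.
  case/orP: xy => [/eqP ->|xy]; first by exists 0 => //; exact: walk0.
  by exists 1%N => //; exact: walk1.
have yxw : exists2 k, walk y x k & (k <= 1)%N.
  by have [k /walk_sym yx k1] := xyw; exists k.
by move=> /sup[->|->] /sup[->|->] //; exists 0 => //; exact: walk0.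
Qed.

Hypothesis conn : gconnected T.

Lemma support_gdist p u v : 0 < sval p u -> 0 < sval p v -> (gdist u v <= 1)%N.
Proof. by move=> pu /(support_walk pu)[k /gdist_le]; exact: leq_trans. Qed.

Let rdist_set p q : set R :=
  [set x | exists u v, [/\ on_edge p u v, on_edge q u v &
                           x = `|sval p u - sval q u|]] `|`
  [set x | exists u v, [/\ 0 < sval p u, 0 < sval q v &
                x = (1 - sval p u) + path_dist R u v + (1 - sval q v)]].

(** Passing from points to nearby vertices changes distances by at most 2, so
    all coarse notions can be checked on vertices. *)
Lemma rdist_le p q : rdist p q <= (gdist (near_vertex p) (near_vertex q))%:R + 2.
Proof.
have := near_gt0 p; have := near_gt0 q.
set u := near_vertex p; set v := near_vertex q => qv pu.
apply: (@le_trans _ _ ((1 - sval p u) + path_dist R u v + (1 - sval q v))).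
  apply: (@ge_inf _ (rdist_set p q)); last by right; exists u, v.
  exists 0 => x [[? [? [_ _ ->]]]|[u' [v' [_ _ ->]]]]; first exact: normr_ge0.
  have := rpoint_le1 p u'; have := rpoint_le1 q v'.
  by have := ler0n R (gdist u' v'); rewrite path_distE //; lra.
by rewrite path_distE //; lra.
Qed.

Lemma rdist_ge p q : (gdist (near_vertex p) (near_vertex q))%:R <= rdist p q + 2.
Proof.
have := near_gt0 p; have := near_gt0 q.
set u := near_vertex p; set v := near_vertex q => qv pu.
rewrite -lerBlDr; apply: (@lb_le_inf _ (rdist_set p q)).
  by exists ((1 - sval p u) + path_dist R u v + (1 - sval q v)); right; exists u, v.
move=> x [[a [b [pe qe ->]]]|[u' [v' [pu' qv' ->]]]].
  have [ab _] := pe.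
  suff : (gdist u v <= 1)%N.
    by rewrite -(ler_nat R) => h; have h2 : 0 <= `|sval p a - sval q a| :> R by []; lra.
  have [ab1 ba1] : (gdist a b <= 1 /\ gdist b a <= 1)%N.
    by split; apply: gdist_le; apply: walk1; rewrite // adj_sym.
  by have [->|->] := on_edge_support pe pu;
     have [->|->] := on_edge_support qe qv; rewrite ?gdist0.
have : (gdist u v <= gdist u' v' + 2)%N.
  have := gdist_triangle conn u u' v; have := gdist_triangle conn u' v' v.
  have := support_gdist pu pu'; have := support_gdist qv' qv.
  by lia.
have := rpoint_le1 p u'; have := rpoint_le1 q v'; rewrite path_distE //.
by rewrite -(ler_nat R) natrD; lra.
Qed.

Lemma near_vertex_act g p :
  (gdist (near_vertex (ract g p)) (vact g (near_vertex p)) <= 1)%N.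
Proof.
apply: (@support_gdist (ract g p)); first exact: near_gt0.
by rewrite /= -vactM mulVg vact1 near_gt0.
Qed.

End Realization.

Section Domination.
Variables (R : realType) (G : groupType).

(** Orbit maps compare two actions: a coarsely Lipschitz and coarsely
    equivariant map is obtained by sending a point near [g y0] to [g x0]. *)
Lemma dominated_orbit (X Y : ggraph G) (x0 : X) (y0 : Y) (A B C : nat) :
    gconnected X -> gconnected Y ->
    (forall y, exists g, (gdist y (vact g y0) <= C)%N) ->
    (forall g, (gdist x0 (vact g x0) <= A * gdist y0 (vact g y0) + B)%N) ->
  dominated (realization R X) (realization R Y).
Proof.
move=> cX cY /choice[f fC] AB.
have AB' g h : (gdist (vact g x0) (vact h x0) <=
                A * gdist (vact g y0) (vact h y0) + B)%N.
  rewrite -(gdist_act cX g^-1%g) -(gdist_act cY g^-1%g).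
  by rewrite -!vactM !mulVg !vact1 AB.
exists (fun p => vertex_point R (vact (f (near_vertex p)) x0)); split.
  exists A%:R, (A * (2 * C + 2) + B + 2)%:R => p q /=.
  have := rdist_le cX (vertex_point R (vact (f (near_vertex p)) x0))
                      (vertex_point R (vact (f (near_vertex q)) x0)).
  rewrite !near_vertex_point => /le_trans; apply.
  have pq := rdist_ge cY p q; set d := rdist p q in pq *.
  set m := gdist (near_vertex p) (near_vertex q) in pq *.
  have : (gdist (vact (f (near_vertex p)) x0) (vact (f (near_vertex q)) x0) <=
          A * (m + 2 * C) + B)%N.
    apply: leq_trans (AB' _ _) _; rewrite leq_add2r leq_mul2l.
    have := gdist_triangle cY (vact (f (near_vertex p)) y0) (near_vertex p)
                              (vact (f (near_vertex q)) y0).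
    have := gdist_triangle cY (near_vertex p) (near_vertex q)
                              (vact (f (near_vertex q)) y0).
    have := fC (near_vertex p); have := fC (near_vertex q).
    by rewrite (gdist_sym cY (vact (f (near_vertex p)) y0) (near_vertex p)) /m; lia.
  rewrite -(ler_nat R) !natrD !natrM !natrD => h.
  by have := ler_wpM2l (ler0n R A) pq; lra.
move=> p; exists (A * (2 * C + 1) + B + 3)%:R => g /=.
set q := ract g p.
have := rdist_le cX (vertex_point R (vact (f (near_vertex q)) x0))
                    (ract g (vertex_point R (vact (f (near_vertex p)) x0))).
move=> /le_trans; apply; rewrite near_vertex_point.
have := near_vertex_act g (vertex_point R (vact (f (near_vertex p)) x0)).
rewrite near_vertex_point -vactM; set z := near_vertex _ => zE.
set h := (g * f (near_vertex p))%g in zE *.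
have : (gdist (vact (f (near_vertex q)) y0) (vact h y0) <= 2 * C + 1)%N.
  have := gdist_triangle cY (vact (f (near_vertex q)) y0) (near_vertex q) (vact h y0).
  have := gdist_triangle cY (near_vertex q) (vact g (near_vertex p)) (vact h y0).
  rewrite /h vactM gdist_act //.
  have := fC (near_vertex p); have := fC (near_vertex q); have := near_vertex_act g p.
  by rewrite (gdist_sym cY (vact (f (near_vertex q)) y0) (near_vertex q)) -/q; lia.
move=> /(leq_mul (leqnn A)) hq.
have := leq_trans (AB' (f (near_vertex q)) h) (leq_add hq (leqnn B)).
have := gdist_triangle cX (vact (f (near_vertex q)) x0) (vact h x0) z.
rewrite (gdist_sym cX (vact h x0) z) => h1 h2.
have : (gdist (vact (f (near_vertex q)) x0) z <= A * (2 * C + 1) + B + 1)%N by lia.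
by rewrite -(ler_nat R) !natrD; lra.
Qed.

Lemma dominated_twist (phi : G -> G) (X Y : gspace R G) : involutive phi ->
  dominated (twist phi X) Y -> dominated X (twist phi Y).
Proof.
move=> phiK [f [fL fE]]; exists f; split => // y.
by have [C fC] := fE y; exists C => g; have := fC (phi g); rewrite /= phiK.
Qed.

Lemma dominated_twist_sym (phi : G -> G) (X Y : gspace R G) : involutive phi ->
  dominated X (twist phi Y) -> dominated (twist phi X) Y.
Proof.
move=> phiK [f [fL fE]]; exists f; split => // y.
by have [C fC] := fE y; exists C => g; have := fC (phi g); rewrite /= phiK.
Qed.

Lemma equivalent_twist (phi : G -> G) (X Y : gspace R G) : involutive phi ->
  equivalent_actions (twist phi X) Y -> equivalent_actions X (twist phi Y).
Proof.
move=> phiK [XY YX]; split; first exact: dominated_twist.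
exact: dominated_twist_sym.
Qed.

End Domination.

(** * Trees with a fixed end *)

Lemma vactK (G : groupType) (T : ggraph G) (g : G) :
  cancel (@vact G T g) (vact g^-1%g).
Proof. by move=> v; rewrite -vactM mulVg vact1. Qed.

Lemma vactVK (G : groupType) (T : ggraph G) (g : G) :
  cancel (@vact G T g^-1%g) (vact g).
Proof. by move=> v; rewrite -vactM mulgV vact1. Qed.

Lemma vact_inj (G : groupType) (T : ggraph G) (g : G) : injective (@vact G T g).
Proof. exact: can_inj (vactK g). Qed.

(** Along a walk, each step either goes up, and is absorbed by one more
    application of [up], or goes down and undoes one. *)
Lemma walk_meet (G : groupType) (T : ggraph G) (up : T -> T) (u v : T) k :
    (forall x y : T, adj x y -> up x = y \/ up y = x) -> walk u v k ->
  exists i j, iter i up u = iter j up v /\ (i + j <= k)%N.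
Proof.
move=> edge; elim: k u => [|k IH] u.
  by move=> [[|? ?] [//= _ -> _]]; exists 0, 0.
move=> /walkS[w uw /IH[i [j [ij ijk]]]].
case: (edge _ _ uw) => [uE|wE].
  by exists i.+1, j; rewrite iterSr uE; split => //; lia.
case: i ij ijk => [|i] ij ijk; last first.
  by exists i, j; rewrite -wE -iterSr; split => //; lia.
by exists 0, j.+1; rewrite /= -ij /= wE; split => //; lia.
Qed.

(** A tree with a distinguished end fixed by the group, seen from that end:
    [up v] is the next vertex on the ray from [v] to the end, [height] is the
    Busemann function, and [shift g] is the amount by which [g] translates
    towards the end. *)
Record fixed_end (G : groupType) (T : ggraph G) (up : T -> T)
    (height : T -> int) (shift : G -> int) : Prop := FixedEnd {
  up_adj : forall v, adj v (up v);
  up_edge : forall u v, adj u v -> up u = v \/ up v = u;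
  up_act : forall g v, up (vact g v) = vact g (up v);
  height_up : forall v, height (up v) = height v + 1;
  height_act : forall g v, height (vact g v) = height v + shift g;
  shiftM : forall g h, shift (g * h)%g = shift g + shift h;
  up_meet : forall u v, exists i j, iter i up u = iter j up v }.

Section FixedEnd.
Variables (G : groupType) (T : ggraph G) (up : T -> T).
Variables (height : T -> int) (shift : G -> int).
Hypothesis H : fixed_end up height shift.
Implicit Types (u v w : T) (g h s : G).

Lemma height_iter k v : height (iter k up v) = height v + k%:Z.
Proof. by elim: k => [|k IH] /=; rewrite ?addr0 // (height_up H) IH; lia. Qed.

Lemma up_act_iter k g v : iter k up (vact g v) = vact g (iter k up v).
Proof. by elim: k => [|k IH] //=; rewrite IH (up_act H). Qed.

Lemma height_meet i j u v :
  iter i up u = iter j up v -> height u + i%:Z = height v + j%:Z.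
Proof. by rewrite -!height_iter => ->. Qed.

Lemma level_meet u v : height u = height v ->
  exists i, iter i up u = iter i up v.
Proof.
move=> uv; have [i [j ij]] := up_meet H u v.
have := height_meet ij; rewrite uv => /addrI [ijE].
by exists i; rewrite {2}ijE.
Qed.

Lemma shift1 : shift 1%g = 0.
Proof. by have := shiftM H 1%g 1%g; rewrite mulg1; lia. Qed.

Lemma shiftV g : shift g^-1%g = - shift g.
Proof. by have := shiftM H g g^-1%g; rewrite mulgV shift1; lia. Qed.

Lemma shiftJ g h : shift (g ^ h)%g = shift g.
Proof. by rewrite conjgE !(shiftM H) shiftV; lia. Qed.

Lemma shiftX g k : shift (g ^+ k)%g = shift g * k%:Z.
Proof.
elim: k => [|k IH]; first by rewrite expg0 shift1 mulr0.
by rewrite expgS (shiftM H) IH; lia.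
Qed.

Lemma shift_commutator : forall g, commutator_subgroup g -> shift g = 0.
Proof.
move=> g cg; apply: (cg [set g | shift g = 0]).
  by split=> [|x y xE yE|x xE] /=; rewrite ?shift1 // ?(shiftM H) ?shiftV ?xE ?yE.
move=> _ [x [y ->]] /=.
by rewrite commgEl (shiftM H) shiftV shiftJ; lia.
Qed.

Lemma fix_up g v k : vact g v = v -> vact g (iter k up v) = iter k up v.
Proof. by move=> gv; rewrite -up_act_iter gv. Qed.

Lemma fixM g h v : vact g v = v -> vact h v = v -> vact (g * h)%g v = v.
Proof. by rewrite vactM => gv ->. Qed.

Lemma fixV g v : vact g v = v -> vact g^-1%g v = v.
Proof. by move=> {1}<-; rewrite vactK. Qed.

Lemma fix_shift g v : vact g v = v -> shift g = 0.
Proof. by move=> gv; have := height_act H g v; rewrite gv; lia. Qed.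

Lemma fixJ g h v : vact (g ^ h)%g v = v <-> vact g (vact h v) = vact h v.
Proof.
rewrite conjgE !vactM; split; last by move=> ->; rewrite vactK.
by move=> E; apply: (@vact_inj _ _ h^-1%g); rewrite E vactK.
Qed.

(** Elements of zero shift are elliptic: they fix a ray towards the end. *)
Lemma shift0_fix g v : shift g = 0 ->
  exists i, vact g (iter i up v) = iter i up v.
Proof.
move=> g0; have [|i] := @level_meet (vact g v) v.
  by rewrite (height_act H) g0 addr0.
by rewrite up_act_iter => iE; exists i.
Qed.

(** The axis of [g], described by what [g] does on it; meaningful when [g]
    translates towards the end. *)
Definition axis g w : Prop := vact g w = iter `|shift g|%N up w.

Lemma axis_nonempty g v : 0 < shift g -> exists k, axis g (iter k up v).
Proof.
move=> g0; have [i [j ij]] := up_meet H (vact g v) v.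
have := height_meet ij; rewrite (height_act H) => hE; exists i.
by rewrite /axis -up_act_iter ij -iterD; congr iter; lia.
Qed.

Lemma axis_up g w k : axis g w -> axis g (iter k up w).
Proof.
by rewrite /axis => gw; rewrite -up_act_iter gw -!iterD addnC.
Qed.

Lemma axisX g w k : axis g w -> vact (g ^+ k)%g w = iter (k * `|shift g|) up w.
Proof.
move=> gw; elim: k => [|k IH]; first by rewrite expg0 vact1.
by rewrite expgSr vactM gw -up_act_iter IH -iterD -mulSn.
Qed.

Lemma axisJ g h w : axis (g ^ h)%g w <-> axis g (vact h w).
Proof.
rewrite /axis shiftJ conjgE !vactM up_act_iter.
split; last by move=> ->; rewrite vactK.
by move=> E; apply: (@vact_inj _ _ h^-1%g); rewrite E vactK.
Qed.

Lemma axis_commute_act g h w : commute h g -> axis g w -> axis g (vact h w).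
Proof. by move=> hg gw; apply/axisJ; rewrite conjgE -hg mulKg. Qed.

(** Two points of the axis at the same height are joined above by some power
    of [g], which is injective. *)
Lemma axis_unique g u v : 0 < shift g -> axis g u -> axis g v ->
  height u = height v -> u = v.
Proof.
move=> g0 gu gv /level_meet[i iE].
have leik : (i <= i * `|shift g|)%N by rewrite leq_pmulr //; lia.
apply: (@vact_inj _ _ (g ^+ i)%g); rewrite !axisX //.
by rewrite -(subnK leik) !iterD iE.
Qed.

Lemma axis_actN g v k : axis g v -> axis g (vact (g ^- k)%g v).
Proof.
by apply: axis_commute_act; apply/commute_sym/commuteV/commuteX.
Qed.

(** The axis is a line without lower end: every point of it lies above some
    translate of a given one. *)
Lemma axis_below g v w : 0 < shift g -> axis g v -> axis g w ->
  exists k i, w = iter i up (vact (g ^- k)%g v).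
Proof.
move=> g0 gv gw; pose k := `|height v - height w|%N.
pose u := vact (g ^- k)%g v.
have hu : height u = height v - shift g * k%:Z.
  by rewrite /u (height_act H) shiftV shiftX.
have le_uw : height u <= height w.
  rewrite hu; have : k%:Z <= shift g * k%:Z by rewrite ler_peMl //; lia.
  by rewrite /k; lia.
exists k, `|height w - height u|%N.
apply: (axis_unique g0 gw); first by apply/axis_up/axis_actN.
by rewrite height_iter -/u; lia.
Qed.

Lemma axis_height g v w : 0 < shift g -> axis g v -> axis g w ->
  height v <= height w -> w = iter `|height w - height v|%N up v.
Proof.
move=> g0 gv gw vw; apply: (axis_unique g0 gw); first exact: axis_up.
by rewrite height_iter; lia.
Qed.

(** [h] moves a point of the axis of [g] along this axis, to the height that
    [shift h] prescribes. *)
Lemma axis_eq g h w : 0 < shift g -> 0 < shift h -> commute h g ->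
  axis g w -> axis h w.
Proof.
move=> g0 h0 hg gw.
apply: (axis_unique g0); first exact: axis_commute_act.
  exact: axis_up.
by rewrite (height_act H) height_iter; lia.
Qed.

Lemma axis_fix g h w : 0 < shift g -> shift h = 0 -> commute h g ->
  axis g w -> vact h w = w.
Proof.
move=> g0 h0 hg gw; apply: (axis_unique g0) => //; first exact: axis_commute_act.
by rewrite (height_act H) h0 addr0.
Qed.

Lemma fix_axis g h v : 0 < shift g -> axis g v ->
    (forall k, vact h (vact (g ^- k)%g v) = vact (g ^- k)%g v) ->
  forall w, axis g w -> vact h w = w.
Proof.
by move=> g0 gv hv w /(axis_below g0 gv)[k [i ->]]; rewrite fix_up.
Qed.

(** If [f] fixes a point [w] of the axis of [g] and [h] commutes with [g ^ f],
    then [h] fixes the axis of [g ^ f] pointwise, which passes through [w]. *)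
Lemma fix_commute_conj g f h w : 0 < shift g -> axis g w -> vact f w = w ->
  shift h = 0 -> commute h (g ^ f)%g -> vact h w = w.
Proof.
move=> g0 gw fw h0 hgf; apply: (@axis_fix (g ^ f)%g); rewrite ?shiftJ //.
by apply/axisJ; rewrite fw.
Qed.

Definition no_invariant_axis : Prop :=
  forall g, 0 < shift g -> ~ forall h w, axis g w -> axis g (vact h w).

Lemma walk_up i w : walk w (iter i up w) i.
Proof.
elim: i w => [|i IH] w; first exact: walk0.
by rewrite iterSr; apply: walk_cons (up_adj H w) (IH _).
Qed.

Lemma walk_up_meet u v i j : iter i up u = iter j up v -> walk u v (i + j).
Proof.
move=> ij; apply: walk_cat (walk_up i u) _.
by rewrite ij; apply/walk_sym/walk_up.
Qed.

Lemma fixed_end_connected : gconnected T.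
Proof.
move=> u v; have [i [j ij]] := up_meet H u v; exists (i + j)%N.
exact: walk_up_meet.
Qed.
Let conn := fixed_end_connected.

Lemma gdist_meet u v i j : iter i up u = iter j up v -> (gdist u v <= i + j)%N.
Proof. by move=> /walk_up_meet/gdist_le. Qed.

(** The geodesic from [u] to [v] goes up and then down. *)
Lemma gdist_meet_le u v :
  exists i j, iter i up u = iter j up v /\ (i + j <= gdist u v)%N.
Proof. exact: (walk_meet (up_edge H) (gdist_walk conn u v)). Qed.

Lemma gdist_height u v : (`|height u - height v| <= gdist u v)%N.
Proof.
have [i [j [/height_meet ij le]]] := gdist_meet_le u v.
by apply: leq_trans le; lia.
Qed.

Lemma gdist_axis g u v : 0 < shift g -> axis g u -> axis g v ->
  gdist u v = `|height u - height v|%N.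
Proof.
move=> g0 gu gv; apply/eqP; rewrite eqn_leq gdist_height andbT.
wlog uv : u v gu gv / height u <= height v.
  move=> W; have [|/ltW vu] := leP (height u) (height v); first exact: W.
  by rewrite gdist_sym // distnC; apply: W.
rewrite {1}(axis_height g0 gu gv uv).
rewrite (leq_trans (@gdist_meet _ _ `|height v - height u|%N 0 _)) //; lia.
Qed.

End FixedEnd.

(** * Bass-Serre trees of ascending HNN-extensions *)

Lemma cobounded_vertex (R : realType) (G : groupType) (T : ggraph G) :
    gconnected T -> cobounded (realization R T) ->
  forall v : T, exists C : nat, forall u : T,
    exists g : G, (gdist u (vact g v) <= C)%N.
Proof.
move=> conn [x0 [C xC]] v.
have [N CN] : exists N : nat, C <= N%:R.
  by exists (Num.bound `|C|); rewrite (le_trans (ler_norm _)) // ltW // archi_boundP.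
exists (N + 3 + gdist (near_vertex x0) v)%N => u.
have [g gC] := xC (vertex_point R u); exists g.
have := gdist_triangle conn u (near_vertex (ract g x0)) (vact g v).
have := gdist_triangle conn (near_vertex (ract g x0)) (vact g (near_vertex x0)) (vact g v).
rewrite gdist_act //; have := near_vertex_act g x0.
suff : (gdist u (near_vertex (ract g x0)) <= N + 2)%N by lia.
have := rdist_ge conn (vertex_point R u) (ract g x0).
rewrite near_vertex_point -(ler_nat R) natrD => h.
by apply: (le_trans h); rewrite lerD2r (le_trans _ CN).
Qed.

Section AscendingHNN.
Variables (G : groupType) (T : ggraph G) (up : T -> T).
Variables (height : T -> int) (shift : G -> int).
Hypothesis H : fixed_end up height shift.
Hypothesis no_line : no_invariant_axis up shift.
Variables (s : G) (v : T).
Hypothesis s_gt0 : 0 < shift s.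
Hypothesis s_dvd : forall g, exists k : int, shift g = k * shift s.
Hypothesis sv : axis up shift s v.
Let conn := fixed_end_connected H.

Definition stabilizer : set G := [set g | vact g v = v].

Lemma stabilizer_subgroup : is_subgroup stabilizer.
Proof.
split=> [|x y xv yv|x xv]; rewrite /stabilizer /= ?vact1 //.
  exact: fixM.
exact: fixV.
Qed.

(** High enough, the rays from [g v] and from [v] have merged into the axis of
    [s]; comparing them there by means of powers of [s] gives a normal form whose
    length is linear in the displacement of [v]. *)
Lemma ascending_decomposition g : exists m k m',
  [/\ stabilizer k, g = (s ^+ m * k * s ^- m')%g &
      (m + m' <= 3 * gdist v (vact g v))%N].
Proof.
have [i [j [ij le]]] := gdist_meet_le H (vact g v) v.
have := height_meet H ij; rewrite (height_act H) => hE.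
have [e eE] := s_dvd g; have c0 := s_gt0; set c := shift s in c0 eE *.
have ej : e <= j%:Z.
  by have [e0|e0] := leP e 0; [lia|have : e <= e * c by rewrite ler_peMr //; lia]; lia.
pose m' := `|j%:Z - e|%N.
have m'E : m'%:Z = j%:Z - e by rewrite /m'; lia.
have m'le : (m' <= 2 * (i + j))%N.
  have [e0|e0] := leP 0 e; first by lia.
  have : e * c <= e by rewrite ger_nMr //; lia.
  by lia.
(* the exponents are chosen so that [g s^m' v] and [s^j v] have the same height,
   at or above the point where the rays from [g v] and [v] meet *)
exists j, (s ^- j * g * s ^+ m')%g, m'; split; last first.
- by rewrite (gdist_sym conn); lia.
- by rewrite -!mulgA mulgV mulg1 mulVKg.
rewrite /stabilizer /= !vactM (axisX H) // -(up_act_iter H) -/c.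
have jc : (j <= j * `|c|)%N by rewrite leq_pmulr //; lia.
have -> : (m' * `|c| = j * `|c| - j + i)%N.
  have : m'%:Z * c = j%:Z * c - j%:Z + i%:Z by rewrite m'E mulrBl -eE; lia.
  have : c = `|c|%N%:Z by lia.
  move: jc; set d := `|c|%N => jc -> {}hE.
  suff : (m' * d + j = j * d + i)%N by lia.
  by apply/eqP; rewrite -eqz_nat !PoszD !PoszM hE; apply/eqP; ring.
by rewrite iterD ij -iterD subnK // -(axisX H _ sv) vactK.
Qed.

(** If conjugation by [s^-1] preserves the stabilizer of [v], then the stabilizer
    fixes all the translates of [v] by negative powers of [s], above which the
    whole axis lies. *)
Lemma stabilizer_powers_axis g : stabilizer g ->
    (forall k, stabilizer k -> stabilizer (k ^ s^-1)%g) ->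
  forall w, axis up shift s w -> vact g w = w.
Proof.
move=> gv sK; apply: (fix_axis H s_gt0 sv) => m.
apply/fixJ; elim: m g gv => [|m IH] g gv; first by rewrite expg0 invg1 conjg1.
by rewrite expgSr invgM conjgM; apply: IH; exact: sK.
Qed.

(** [s v] lies above [v], hence is fixed by whatever fixes [v]. Equality of the
    two stabilizers would make the axis of [s] invariant under the group. *)
Lemma ascending_hnn : strictly_ascending_hnn stabilizer s.
Proof.
have [K1 KM KV] := stabilizer_subgroup.
split=> //.
- move=> k k0 sk; have := shiftX H s k; rewrite sk (shift1 H).
  by move/esym/eqP; rewrite mulf_eq0; lia.
- split=> [_ [k kv <-]|sK].
    by apply/fixJ; rewrite sv (fix_up H).
  apply: (no_line s_gt0) => h w sw.
  have [m [k [m' [kv -> _]]]] := ascending_decomposition h.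
  rewrite !vactM; apply: (axis_commute_act H); first exact/commute_sym/commuteX.
  have sw' : axis up shift s (vact (s ^- m')%g w) by exact: (axis_actN H).
  rewrite (stabilizer_powers_axis kv) // => k' /sK[k'' k''v <-].
  by rewrite conjgK.
- apply/seteqP; split => // g _ L [L1 LM LV] KL.
  have LX m : L (s ^+ m)%g.
    elim: m => [|m IH]; first by rewrite expg0.
    by rewrite expgS; apply: LM => //; apply: KL; right.
  have [m [k [m' [kv -> _]]]] := ascending_decomposition g.
  by apply: (LM); [apply: (LM) => //; apply: KL; left|apply: LV].
apply/seteqP; split=> [x [sx xv]|_ ->]; last first.
  by split=> // L [].
(* products [s^a s^-b] avoid integer exponents *)
pose P := [set x | exists a b, x = (s ^+ a * s ^- b)%g].
have [a [b xE]] : P x.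
  apply: sx; last by move=> _ ->; exists 1%N, 0; rewrite expg1 expg0 invg1 mulg1.
  split; first by exists 0, 0; rewrite expg0 invg1 mulg1.
    move=> _ _ [a [b ->]] [c [d ->]]; exists (a + c)%N, (d + b)%N.
    have com : commute (s ^- b)%g (s ^+ c)%g.
      exact/commute_sym/commuteV/commuteX2.
    by rewrite -mulgA [X in (_ * X)%g]mulgA com !expgnDr invgM !mulgA.
  by move=> _ [a [b ->]]; exists b, a; rewrite invgM invgK.
have := fix_shift H xv; rewrite xE (shiftM H) (shiftV H) !(shiftX H) -mulrBr.
move=> /eqP; rewrite mulf_eq0 => /orP[|/eqP ab]; first by lia.
by rewrite (_ : a = b) ?mulgV //; lia.
Qed.

Let X := bass_serre_tree stabilizer s.

Lemma coset_vertex_subproof g : coset stabilizer g \in range (coset stabilizer).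
Proof. by apply/mem_set; exists g. Qed.

Definition coset_vertex g : X :=
  exist (fun D => D \in range (coset stabilizer)) _ (coset_vertex_subproof g).

Lemma coset_vertex_surj (C : X) : exists g, C = coset_vertex g.
Proof.
case: C => C CE; have [g _ gE] := set_mem CE.
by exists g; apply: val_inj.
Qed.

Lemma coset_vertex_act g h : vact g (coset_vertex h) = coset_vertex (g * h)%g.
Proof. by apply: val_inj; rewrite /= image_coset. Qed.

Lemma coset_vertexM g k : stabilizer k ->
  coset_vertex (g * k)%g = coset_vertex g.
Proof.
have [_ KM KV] := stabilizer_subgroup.
move=> kv; apply: val_inj => /=; apply/seteqP; split=> _ [x xv <-].
  by rewrite -mulgA; exists (k * x)%g => //; apply: KM.
by exists (k^-1 * x)%g; [apply: KM => //; exact: KV|rewrite mulgA mulgK].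
Qed.

Lemma coset_eq_act g h : coset stabilizer g = coset stabilizer h ->
  vact g v = vact h v.
Proof.
move=> gh; have : coset stabilizer g g.
  by exists 1%g; [case: stabilizer_subgroup|rewrite mulg1].
by rewrite gh => -[k kv <-]; rewrite vactM kv.
Qed.

Lemma coset_walkX g m : exists2 k,
  walk (coset_vertex g) (coset_vertex (g * s ^+ m)%g) k & (k <= m)%N.
Proof.
elim: m => [|m [k gk km]].
  by exists 0 => //; rewrite expg0 mulg1; exact: walk0.
rewrite expgSr mulgA; set h := (g * s ^+ m)%g in gk *.
have [hE|hN] := eqVneq (coset_vertex h) (coset_vertex (h * s)%g).
  by exists k; rewrite -?hE // leqW.
exists (k + 1)%N; last by rewrite addn1.
apply: walk_cat gk _; apply: walk1.
by rewrite /= /bs_adj hN; apply/asboolP; left; exists h.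
Qed.

Lemma coset_walk g : exists2 k, walk (coset_vertex 1%g) (coset_vertex g) k &
  (k <= 3 * gdist v (vact g v))%N.
Proof.
have [m [k [m' [kv gE le]]]] := ascending_decomposition g.
have [a aw am] := coset_walkX 1%g m; have [b bw bm'] := coset_walkX g m'.
exists (a + b)%N; last by apply: leq_trans le; apply: leq_add.
apply: walk_cat aw _; apply: walk_sym; rewrite mul1g.
have <- : coset_vertex (g * s ^+ m')%g = coset_vertex (s ^+ m)%g.
  by rewrite -(coset_vertexM (s ^+ m)%g kv) gE mulgVK.
exact: bw.
Qed.

Lemma bass_serre_connected : gconnected X.
Proof.
move=> C D; have [g ->] := coset_vertex_surj C; have [h ->] := coset_vertex_surj D.
have [k kw _] := coset_walk (g^-1 * h)%g; exists k.
by have := walk_act g kw; rewrite !coset_vertex_act mulg1 mulVKg.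
Qed.

Lemma walk_coset_gdist k g h : walk (coset_vertex g) (coset_vertex h) k ->
  (gdist (vact g v) (vact h v) <= gdist v (vact s v) * k)%N.
Proof.
elim: k g => [|k IH] g.
  move=> [[|? ?] [//= _ gh _]]; move/(congr1 val): gh => /= /coset_eq_act ->.
  by rewrite gdist0.
move=> /walkS[w]; have [g' ->] := coset_vertex_surj w.
move=> gg' /IH le; have := gdist_triangle conn (vact g v) (vact g' v) (vact h v).
suff : (gdist (vact g v) (vact g' v) <= gdist v (vact s v))%N by lia.
case/andP: gg' => _ /asboolP[] [x [/= /coset_eq_act -> /coset_eq_act ->]].
  by rewrite vactM gdist_act.
by rewrite vactM (gdist_sym conn) gdist_act.
Qed.

(** The action on the tree is recovered, up to equivalence, from the
    stabilizer of a point of the axis: both orbit maps are coarsely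
    Lipschitz. *)
Lemma bass_serre_equivalent (R : realType) : cobounded (realization R T) ->
  equivalent_actions (realization R T)
                     (realization R (bass_serre_tree stabilizer s)).
Proof.
move=> /(cobounded_vertex conn)/(_ v)[C vC]; split.
  apply: (@dominated_orbit _ _ _ X v (coset_vertex 1%g) (gdist v (vact s v)) 0 0).
  - exact: conn.
  - exact: bass_serre_connected.
  - move=> D; have [g ->] := coset_vertex_surj D; exists g.
    by rewrite coset_vertex_act mulg1 gdist0.
  - move=> g; have := gdist_walk bass_serre_connected (coset_vertex 1%g) (coset_vertex g).
    by move=> /walk_coset_gdist; rewrite vact1 addn0 coset_vertex_act mulg1.
apply: (@dominated_orbit _ _ X _ (coset_vertex 1%g) v 3 0 C) => //.
- exact: bass_serre_connected.
- move=> g; rewrite coset_vertex_act mulg1 addn0.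
  by have [k /gdist_le kw] := coset_walk g; apply: leq_trans.
Qed.

End AscendingHNN.

(** * The end fixed by a quasi-parabolic action *)

Definition eventually_nat (P : nat -> Prop) : Prop :=
  exists N, forall k, (N <= k)%N -> P k.

Lemma eventually_and (P Q : nat -> Prop) :
  eventually_nat P -> eventually_nat Q -> eventually_nat (fun k => P k /\ Q k).
Proof.
move=> [N NP] [M MQ]; exists (maxn N M) => k; rewrite geq_max => /andP[Nk Mk].
by split; [exact: NP|exact: MQ].
Qed.

Lemma eventually_ex (P : nat -> Prop) : eventually_nat P -> exists k, P k.
Proof. by move=> [N NP]; exists N; apply: NP. Qed.

Section VertexSequences.
Variables (G : groupType) (T : ggraph G).
Hypothesis treeT : is_tree T.
Let conn := tree_connected treeT.
Implicit Types (x y z : nat -> T) (o u v w : T) (g : G).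

(** Divergence of Gromov products, for sequences of vertices. *)
Definition asymptotic x y : Prop := forall o (m : nat), exists N, forall i j,
  (N <= i)%N -> (N <= j)%N ->
  (2 * m + gdist (x i) (y j) <= gdist o (x i) + gdist o (y j))%N.

Lemma asymptotic_base o x y : (forall m : nat, exists N, forall i j,
    (N <= i)%N -> (N <= j)%N ->
    (2 * m + gdist (x i) (y j) <= gdist o (x i) + gdist o (y j))%N) ->
  asymptotic x y.
Proof.
move=> oP o' m; have [N NP] := oP (m + gdist o o')%N; exists N => i j Ni Nj.
have := gdist_triangle conn o o' (x i); have := gdist_triangle conn o o' (y j).
by have := NP i j Ni Nj; lia.
Qed.

Lemma asymptotic_sym x y : asymptotic x y -> asymptotic y x.
Proof.
move=> xy o m; have [N NP] := xy o m; exists N => i j Ni Nj.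
by have := NP j i Nj Ni; rewrite (gdist_sym conn (x j)); lia.
Qed.

Lemma asymptotic_trans y x z : asymptotic x y -> asymptotic y z -> asymptotic x z.
Proof.
move=> xy yz o m; have [N NP] := xy o m; have [M MP] := yz o m.
exists (maxn N M) => i j; rewrite !geq_max => /andP[Ni Mi] /andP[Nj Mj].
apply: (four_point treeT (y := y (maxn N M))).
  by apply: NP; rewrite // leq_maxl.
by apply: MP; rewrite // leq_maxr.
Qed.

Lemma asymptotic_close D x x' y : (forall i, (gdist (x i) (x' i) <= D)%N) ->
  asymptotic x y -> asymptotic x' y.
Proof.
move=> xx' xy o m; have [N NP] := xy o (m + D)%N; exists N => i j Ni Nj.
have := gdist_triangle conn o (x' i) (x i); have := xx' i.
have := gdist_triangle conn (x' i) (x i) (y j); have := NP i j Ni Nj.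
by rewrite (gdist_sym conn (x' i) (x i)); lia.
Qed.

(** Positive Gromov products at [v]: from some index on, both sequences leave [v]
    through the same edge. *)
Lemma asymptotic_step v x y : asymptotic x y ->
  exists N, forall i j, (N <= i)%N -> (N <= j)%N ->
  exists u, [/\ adj v u, (gdist u (x i) < gdist v (x i))%N &
                (gdist u (y j) < gdist v (y j))%N].
Proof.
move=> /(_ v 1)[N NP]; exists N => i j Ni Nj.
have {NP} := NP i j Ni Nj => xy.
have [|||u [vu -> ->]] := common_first_step treeT (o := v) (x := x i) (y := y j).
- by lia.
- by apply: contraTneq xy => ->; rewrite gdist0; lia.
- by apply: contraTneq xy => ->; rewrite gdist0 gdist_sym //; lia.
by exists u.
Qed.

Variable x : nat -> T.
Hypothesis xx : asymptotic x x.
Hypothesis xg : forall g, asymptotic x (fun i => vact g (x i)).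

Definition nearer u v : Prop :=
  eventually_nat (fun k => (gdist u (x k) < gdist v (x k))%N).

(** The first vertex after [v] on the ray from [v] to the limit of [x]. *)
Definition end_up v : T := xget v [set u | adj v u /\ nearer u v].

Lemma nearer_unique v u w : adj v u -> adj v w -> nearer u v -> nearer w v -> u = w.
Proof.
move=> vu vw uv wv; have [k [ku kw]] := eventually_ex (eventually_and uv wv).
by apply: (nearer_neighbour_unique treeT vu vw (x := x k)); exact: ltnW.
Qed.

Lemma end_upP v : adj v (end_up v) /\ nearer (end_up v) v.
Proof.
rewrite /end_up; case: xgetP => [u _ //|] noU; exfalso.
have [N NP] := asymptotic_step v xx.
have [u [vu uN _]] := NP N N (leqnn _) (leqnn _).
apply: (noU u); split=> //; exists N => k Nk.
have [u' [vu' u'N u'k]] := NP N k (leqnn _) Nk.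
suff -> : u = u' by [].
by apply: (nearer_neighbour_unique treeT vu vu' (x := x N)); exact: ltnW.
Qed.

Lemma end_up_eq v u : adj v u -> nearer u v -> end_up v = u.
Proof. by have [a b] := end_upP v => vu uv; exact: nearer_unique a vu b uv. Qed.

Lemma end_up_edge u v : adj u v -> end_up u = v \/ end_up v = u.
Proof.
move=> uv; have [->|/eqP ne] := eqVneq (end_up u) v; first by left.
right; apply: end_up_eq; first by rewrite adj_sym.
have [a [N b]] := end_upP u; exists N => k /b Nk.
rewrite ltnNge; apply/negP => vk; apply: ne.
by apply: (nearer_neighbour_unique treeT a uv (ltnW Nk) vk).
Qed.

(** Translating the sequence does not change its limit, which is fixed. *)
Lemma end_up_act g v : end_up (vact g v) = vact g (end_up v).
Proof.
have [a [M b]] := end_upP v.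
apply: end_up_eq; first by rewrite vact_adj.
have [N NP] := asymptotic_step (vact g v) (xg g).
exists N => k Nk.
have [u [vu uk uM]] := NP k (maxn N M) Nk (leq_maxl _ _).
suff -> : vact g (end_up v) = u by [].
apply: (nearer_neighbour_unique treeT (v := vact g v) (x := vact g (x (maxn N M)))) => //.
- by rewrite vact_adj.
- by rewrite !gdist_act // ltnW // b // leq_maxr.
- exact: ltnW.
Qed.

Lemma end_up_gdist i v :
  eventually_nat (fun k => gdist v (x k) = (gdist (iter i end_up v) (x k) + i)%N).
Proof.
elim: i => [|i IH]; first by exists 0 => k _; rewrite addn0.
have [a b] := end_upP (iter i end_up v).
have [N NP] := eventually_and IH b; exists N => k /NP[-> lt].
by have := gdist_adj conn (x k) a; rewrite iterS; lia.
Qed.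

Variable o : T.

(** The Busemann function of the limit of [x], normalized at [o]. *)
Definition busemann v : int := xget 0 [set z : int |
  eventually_nat (fun k => (gdist o (x k))%:Z - (gdist v (x k))%:Z = z)].

Lemma busemann_eq v (z : int) :
    eventually_nat (fun k => (gdist o (x k))%:Z - (gdist v (x k))%:Z = z) ->
  busemann v = z.
Proof.
move=> zP; rewrite /busemann; case: xgetP => [z1 _ z1P|/(_ z) //].
by have [k [<- <-]] := eventually_ex (eventually_and zP z1P).
Qed.

Lemma end_up_meet u v : exists i j, iter i end_up u = iter j end_up v.
Proof.
have [i [j [ij _]]] := walk_meet end_up_edge (gdist_walk conn u v).
by exists i, j.
Qed.

Lemma busemann_meet v i j : iter i end_up v = iter j end_up o ->
  busemann v = j%:Z - i%:Z.
Proof.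
move=> ij; apply: busemann_eq.
have [N NP] := eventually_and (end_up_gdist i v) (end_up_gdist j o).
by exists N => k /NP[-> ->]; rewrite ij; lia.
Qed.

Lemma end_fixed : exists up height shift, @fixed_end G T up height shift.
Proof.
have hup v : busemann (end_up v) = busemann v + 1.
  have [i [j ij]] := end_up_meet v o.
  rewrite (busemann_meet ij) (@busemann_meet _ i j.+1); first by lia.
  by rewrite -iterSr !iterS ij.
have hiter i v : busemann (iter i end_up v) = busemann v + i%:Z.
  by elim: i => [|i IH] /=; rewrite ?addr0 // hup IH; lia.
have acti i g v : iter i end_up (vact g v) = vact g (iter i end_up v).
  by elim: i => [|i IH] //=; rewrite IH end_up_act.
have hact g v : busemann (vact g v) = busemann v + (busemann (vact g o) - busemann o).
  have [i [j ij]] := end_up_meet v o.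
  have := hiter i (vact g v); rewrite acti ij -acti hiter.
  by have := hiter i v; rewrite ij hiter; lia.
exists end_up, busemann, (fun g => busemann (vact g o) - busemann o).
split=> //.
- by move=> v; have [] := end_upP v.
- exact: end_up_edge.
- exact: end_up_act.
- by move=> g h; rewrite vactM hact; lia.
- exact: end_up_meet.
Qed.

End VertexSequences.

Section QuasiParabolic.
Variables (R : realType) (G : groupType) (T : ggraph G).
Hypothesis treeT : is_tree T.
Let conn := tree_connected treeT.
Local Notation X := (realization R T).
Implicit Types s t : nat -> X.

Definition vertices s : nat -> T := fun i => near_vertex (s i).

Lemma product_divergesP s t :
  product_diverges s t <-> asymptotic (vertices s) (vertices t).
Proof.
split=> st.
  move=> o m; have [N NP] := st (vertex_point R o) (m + 3)%:R.
  exists N => i j Ni Nj; have := NP i j Ni Nj; rewrite /gromov_product /=.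
  have := rdist_le conn (s i) (vertex_point R o).
  have := rdist_le conn (t j) (vertex_point R o).
  have := rdist_ge conn (s i) (t j); rewrite !near_vertex_point.
  rewrite -/(vertices s i) -/(vertices t j) !(gdist_sym conn _ o) => h1 h2 h3 h4.
  rewrite -(ler_nat R) !natrD.
  by move: h4; rewrite ler_pdivlMr // natrD; lra.
move=> o M.
have [m Mm] : exists m : nat, M + 3 <= m%:R.
  exists (Num.bound `|M + 3|).
  by rewrite (le_trans (ler_norm _)) // ltW // archi_boundP.
have [N NP] := st (near_vertex o) m; exists N => i j Ni Nj.
have := NP i j Ni Nj; rewrite -(ler_nat R) !natrD => hN.
rewrite /gromov_product /= ler_pdivlMr //.
have := rdist_ge conn (s i) o; have := rdist_ge conn (t j) o.
have := rdist_le conn (s i) (t j).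
rewrite !(gdist_sym conn _ (near_vertex o)).
by move: hN; rewrite /vertices; lra.
Qed.

Lemma vertices_act g s i :
  (gdist (vertices (fun i => act g (s i)) i) (vact g (vertices s i)) <= 1)%N.
Proof. exact: near_vertex_act. Qed.

Lemma quasi_parabolic_fixed_end : quasi_parabolic X ->
  exists up height shift, @fixed_end G T up height shift.
Proof.
move=> [_ [_ [s ss <-] gxi]].
have o : T := vertices s 0.
apply: (end_fixed treeT (x := vertices s)) => //; first exact/product_divergesP.
move=> g; apply: (asymptotic_sym treeT).
apply: (asymptotic_close treeT (D := 1)); first exact: (vertices_act g s).
apply/(asymptotic_sym treeT)/product_divergesP.
set zeta := [set t | _] in gxi.
have : zeta (fun i => act g (s i)) by rewrite -(gxi g); exists s.
by case.
Qed.

Section InvariantLine.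
Variables (up : T -> T) (height : T -> int) (shift : G -> int).
Hypothesis H : fixed_end up height shift.

(** If a line were invariant, all orbits would stay at bounded distance from
    it, and only its two ends could be limits. *)
Lemma quasi_parabolic_no_axis : quasi_parabolic X -> no_invariant_axis up shift.
Proof.
move=> [infX [_ [s0 _ _] _]] g g0 gP; apply: infX.
have [k gv] := axis_nonempty H (vertices s0 0) g0.
set v := iter k up _ in gv.
(* the limit points approached along the upper, resp. lower, half of the line *)
pose side (b : bool) : set (set (nat -> X)) := [set xi | @boundary R G X xi /\
  exists (p : X) (h : nat -> G), xi (fun i => act (h i) p) /\
    eventually_nat (fun i => (height v <= height (vact (h i) v)) = b)].
have orbit_close (p : X) (h : nat -> G) i :
    (gdist (vertices (fun i => act (h i) p) i) (vact (h i) v) <=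
     gdist (near_vertex p) v + 1)%N.
  have := gdist_triangle conn (vertices (fun i => act (h i) p) i)
    (vact (h i) (near_vertex p)) (vact (h i) v).
  by rewrite gdist_act //; have := near_vertex_act (h i) p; rewrite /vertices /=; lia.
have axis_gdist (h h' : nat -> G) i j :
    [/\ gdist (vact (h i) v) (vact (h' j) v) =
        `|height (vact (h i) v) - height (vact (h' j) v)|%N,
        gdist v (vact (h i) v) = `|height v - height (vact (h i) v)|%N &
        gdist v (vact (h' j) v) = `|height v - height (vact (h' j) v)|%N].
  by split; apply: (gdist_axis H g0) => //; apply: gP.
have conv_orbit (xi : set (nat -> X)) (p : X) (h : nat -> G) :
    @boundary R G X xi -> xi (fun i => act (h i) p) ->
  asymptotic (fun i => vact (h i) v) (fun i => vact (h i) v).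
  move=> [s ss <-] [/product_divergesP pp _].
  have close := asymptotic_close treeT (orbit_close p h).
  by apply/close/(asymptotic_sym treeT)/close.
have limit_side : @limit_set R G X `<=` side true `|` side false.
  move=> xi [bxi [p [h xih]]].
  have [N NP] := conv_orbit xi p h bxi xih v 1.
  suff : side (height v <= height (vact (h N) v)) xi by case: (_ <= _); [left|right].
  split=> //; exists p, h; split=> //; exists N => i Ni.
  have := NP i N Ni (leqnn _); have [-> -> ->] := axis_gdist h h i N; lia.
have side_unique b xi xi' : side b xi -> side b xi' -> xi = xi'.
  move=> [bxi [p [h [xih hb]]]] [bxi' [p' [h' [xih' h'b]]]].
  have hh := conv_orbit _ _ _ bxi xih; have hh' := conv_orbit _ _ _ bxi' xih'.
  have hh'A : asymptotic (fun i => vact (h i) v) (fun i => vact (h' i) v).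
    apply: (asymptotic_base treeT (o := v)) => m.
    have [N NP] := hh v m; have [M MP] := hh' v m.
    have [K KP] := eventually_and hb h'b.
    exists (maxn K (maxn N M)) => i j.
    rewrite !geq_max => /and3P[Ki Ni Mi] /and3P[Kj Nj Mj].
    have := NP i i Ni Ni; have := MP j j Mj Mj; rewrite !gdist0.
    have [hb1 _] := KP i Ki; have [_ hb2] := KP j Kj.
    have [-> -> ->] := axis_gdist h h' i j.
    by case: (b) hb1 hb2 => hb1 hb2; lia.
  have close := asymptotic_close treeT (orbit_close p h).
  have tt' : asymptotic (vertices (fun i => act (h i) p))
                        (vertices (fun i => act (h' i) p')).
    apply: (asymptotic_close treeT (D := gdist (near_vertex p) v + 1)
                                   (x := fun i => vact (h i) v)).
      by move=> i; rewrite gdist_sym.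
    apply/(asymptotic_sym treeT).
    apply: (asymptotic_close treeT (D := gdist (near_vertex p') v + 1)
                                   (x := fun i => vact (h' i) v)).
      by move=> i; rewrite gdist_sym.
    exact/(asymptotic_sym treeT).
  have [s ss xiE] := bxi; have [s' ss' xiE'] := bxi'.
  have st : asymptotic (vertices s) (vertices (fun i => act (h i) p)).
    by move: xih; rewrite -xiE => -[_ /product_divergesP].
  have st' : asymptotic (vertices s') (vertices (fun i => act (h' i) p')).
    by move: xih'; rewrite -xiE' => -[_ /product_divergesP].
  have s's : asymptotic (vertices s') (vertices s).
    apply: (asymptotic_trans treeT st'); apply: (asymptotic_sym treeT).
    exact: (asymptotic_trans treeT st tt').
  rewrite -xiE -xiE'; apply/seteqP; split=> t [tt /product_divergesP stt];
    split=> //; apply/product_divergesP; apply: (asymptotic_trans treeT _ stt) => //.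
  exact: (asymptotic_sym treeT).
have side_finite b : finite_set (side b).
  have [[xi xib]|no] := pselect (exists xi, side b xi).
    by apply: (@sub_finite_set _ _ [set xi]) => // xi' /side_unique; apply.
  rewrite (_ : side b = set0) //; apply/seteqP; split => // xi xib.
  by case: no; exists xi.
apply: (sub_finite_set limit_side).
by rewrite finite_setU; split.
Qed.

(** Otherwise all the orbits would stay at bounded height, while rays to the
    fixed end have unbounded height. *)
Lemma cobounded_shift : cobounded X -> exists g, 0 < shift g.
Proof.
move=> cob; have [x0 _] := cob; pose v := near_vertex x0.
have [C vC] := cobounded_vertex conn cob v.
have [g gC] := vC (iter C.+1 up v).
have := gdist_height H (iter C.+1 up v) (vact g v).
rewrite (height_iter H) (height_act H) => gh.
have [g0|g0] := ltP 0 (shift g); first by exists g.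
exists g^-1%g; rewrite (shiftV H); lia.
Qed.

(** The shifts form a subgroup of the integers, generated by its least positive
    element. *)
Lemma minimal_shift : (exists g, 0 < shift g) ->
  exists c, 0 < shift c /\ forall g, exists k : int, shift g = k * shift c.
Proof.
move=> [g0 g0_gt0].
pose P m := `[< exists g, shift g = m.+1%:Z >].
have exP : exists m, P m.
  by exists `|shift g0|.-1; apply/asboolP; exists g0; lia.
case: (ex_minnP exP) => m /asboolP[c cE] min.
exists c; split=> [|g]; first by rewrite cE.
have [t tE] : exists t : G, shift t = (shift g %/ shift c)%Z * shift c.
  case: (shift g %/ shift c)%Z => q.
    by exists (c ^+ q)%g; rewrite (shiftX H) mulrC.
  by exists (c ^- q.+1)%g; rewrite (shiftV H) (shiftX H) NegzE; lia.
exists (shift g %/ shift c)%Z.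
have c0 : shift c != 0 by rewrite cE.
have := divz_eq (shift g) (shift c); have := modz_ge0 (shift g) c0.
have c_gt0 : 0 < shift c by rewrite cE.
have := ltz_pmod (shift g) c_gt0.
move=> rlt r0 gE; set r := (shift g %% shift c)%Z in rlt r0 gE.
have [r_0|rN] := eqVneq r 0; first by move: gE; rewrite r_0 addr0.
have : P `|r|.-1.
  by apply/asboolP; exists (g * t^-1)%g; rewrite (shiftM H) (shiftV H) tE; lia.
by move=> /min; rewrite cE in rlt; lia.
Qed.

End InvariantLine.

End QuasiParabolic.

(** Nothing here is specific to F_n: the fixed end gives an element [s] of minimal
    positive shift, and the stabilizer of a point of its axis is the base. *)
Theorem quasi_parabolic_hnn (R : realType) (G : groupType) (T : ggraph G) :
    is_tree T -> cobounded (realization R T) ->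
    quasi_parabolic (realization R T) ->
  exists (K : set G) (s : G), strictly_ascending_hnn K s /\
    equivalent_actions (realization R T) (realization R (bass_serre_tree K s)).
Proof.
move=> treeT cob qp.
have [up [height [shift H]]] := quasi_parabolic_fixed_end treeT qp.
have no_line := quasi_parabolic_no_axis treeT H qp.
have [s [s0 s_dvd]] := minimal_shift H (cobounded_shift treeT H cob).
have [x0 _] := cob.
have [k sv] := axis_nonempty H (near_vertex x0) s0.
exists (stabilizer (iter k up (near_vertex x0))), s; split.
  exact: (ascending_hnn H no_line s0 s_dvd sv).
exact: (bass_serre_equivalent H s0 s_dvd sv cob).
Qed.

(** * The groups F_n *)

Lemma FnM (R : realType) (n : nat) (f g : Fn R n) x : (f * g)%g x = g (f x).
Proof. by []. Qed.

Lemma Fn1 (R : realType) (n : nat) x : (1%g : Fn R n) x = x.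
Proof. by []. Qed.

Section Shrink.
Variables (K : realFieldType) (N d : K).
Hypotheses (d_gt0 : 0 < d) (d_le : d <= 1 / 2) (Nd : N * d = 1).
Local Notation e := (d * d).
Implicit Types x y : K.

(** A map moving every point of (0,1) down, with slopes d, 1 and N = 1/d and
    breakpoints d and 1 - d^2; for N = n it belongs to F_n. *)
Definition shrink_fun x : K :=
  if x <= 0 then x else if x <= d then d * x
  else if x <= 1 - e then x - (d - e) else if x <= 1 then 1 - N * (1 - x) else x.

Let e_gt0 : 0 < e. Proof. exact: mulr_gt0. Qed.
Let e_le : e <= d / 2. Proof. by have := ler_wpM2l (ltW d_gt0) d_le; lra. Qed.
Let Ne : N * e = d. Proof. by rewrite mulrA Nd mul1r. Qed.
Let N_gt0 : 0 < N. Proof. by rewrite -(pmulr_lgt0 _ d_gt0) Nd. Qed.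

Let shrink_low x : x <= 0 -> shrink_fun x = x.
Proof. by rewrite /shrink_fun => ->. Qed.

Lemma shrink_piece0 x : 0 <= x -> x <= d -> shrink_fun x = d * x.
Proof.
rewrite /shrink_fun => x0 xd; case: ifP => x0'; last by rewrite xd.
by rewrite (_ : x = 0) ?mulr0 //; apply/eqP; rewrite eq_le x0'.
Qed.

Lemma shrink_piece1 x : d <= x -> x <= 1 - e -> shrink_fun x = x - (d - e).
Proof.
move=> dx xe; have [xd|xd] := eqVneq x d.
  by rewrite shrink_piece0 xd ?lexx ?(ltW d_gt0) // subKr.
rewrite /shrink_fun xe !leNgt (lt_le_trans d_gt0 dx) /=.
by rewrite lt_neqAle eq_sym xd dx.
Qed.

Lemma shrink_piece2 x : 1 - e <= x -> x <= 1 -> shrink_fun x = 1 - N * (1 - x).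
Proof.
have de : d < 1 - e by have := d_le; have := e_le; have := d_gt0; lra.
move=> ex x1; have [xe|xe] := eqVneq x (1 - e).
  by rewrite shrink_piece1 xe ?lexx ?(ltW de) // subKr Ne; lra.
rewrite /shrink_fun x1 !leNgt (lt_le_trans d_gt0 (ltW (lt_le_trans de ex))) /=.
by rewrite (lt_le_trans de ex) /= lt_neqAle eq_sym xe ex.
Qed.

Let shrink_high x : 1 < x -> shrink_fun x = x.
Proof.
move=> x1; have xe : 1 - e < x by have := e_gt0; lra.
have xd : d < x by have := d_le; lra.
by rewrite /shrink_fun !leNgt x1 xe xd (lt_trans ltr01 x1).
Qed.

Lemma shrink_cases x : [\/ x <= 0 /\ shrink_fun x = x,
  [/\ 0 < x, x <= d, shrink_fun x = d * x, 0 < d * x & d * x <= e],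
  [/\ d < x, x <= 1 - e & shrink_fun x = x - (d - e)] |
  [/\ 1 - e < x, x <= 1, shrink_fun x = 1 - N * (1 - x), 0 <= N * (1 - x) &
      N * (1 - x) < d] \/ 1 < x /\ shrink_fun x = x].
Proof.
have [x0|x0] := leP x 0; first by constructor 1; rewrite shrink_low.
have [xd|xd] := leP x d.
  by constructor 2; rewrite shrink_piece0 ?(ltW x0) // mulr_gt0 // ler_pM2l.
have [xe|xe] := leP x (1 - e); first by constructor 3; rewrite shrink_piece1 ?(ltW xd).
have [x1|x1] := leP x 1; last by constructor 4; right; rewrite shrink_high.
constructor 4; left; rewrite shrink_piece2 ?(ltW xe) // mulr_ge0 ?(ltW N_gt0) ?subr_ge0 //.
by split=> //; rewrite -[ltRHS]Ne ltr_pM2l //; lra.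
Qed.

Lemma shrink_homo : {homo shrink_fun : x y / x < y}.
Proof.
move=> x y xy.
have dxy : d * x < d * y by rewrite ltr_pM2l.
have Nxy : N * (1 - y) < N * (1 - x) by rewrite ltr_pM2l //; lra.
have := d_gt0; have := e_gt0; have := e_le; have := d_le.
by case: (shrink_cases x) => [[? ->]|[? ? -> ? ?]|[? ? ->]|[[? ? -> ? ?]|[? ->]]];
   case: (shrink_cases y) => [[? ->]|[? ? -> ? ?]|[? ? ->]|[[? ? -> ? ?]|[? ->]]]; lra.
Qed.

Lemma shrink_surj y : exists x, shrink_fun x = y.
Proof.
have dp := d_gt0; have e0 := e_gt0; have ed := e_le; have d1 := d_le; have N0 := N_gt0.
have [y0|y0] := leP y 0; first by exists y; exact: shrink_low.
have [ye|ye] := leP y e.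
  exists (N * y); rewrite shrink_piece0 ?mulr_ge0 ?(ltW N0) ?(ltW y0) //.
    by rewrite mulrA [d * N]mulrC Nd mul1r.
  by rewrite -[leRHS]Ne ler_pM2l.
have [yd|yd] := leP y (1 - d).
  by exists (y + (d - e)); rewrite shrink_piece1; lra.
have [y1|y1] := leP y 1; last by exists y; exact: shrink_high.
have h1 : d * (1 - y) <= e by rewrite ler_pM2l //; lra.
have h2 : 0 <= d * (1 - y) by rewrite mulr_ge0 ?(ltW d_gt0) // subr_ge0.
exists (1 - d * (1 - y)).
by rewrite shrink_piece2 ?subKr ?mulrA ?Nd ?mul1r ?subKr //; lra.
Qed.

Lemma shrink_out x : ~~ (0 <= x <= 1) -> shrink_fun x = x.
Proof.
move=> xN; have [x0|x0] := leP x 0; first exact: shrink_low.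
by apply: shrink_high; rewrite ltNge; apply: contra xN => ->; rewrite ltW.
Qed.

Lemma shrink_fun_fix x : 0 <= x < 1 -> shrink_fun x = x -> x = 0.
Proof.
have dp := d_gt0; have e0 := e_gt0; have ed := e_le; have d1 := d_le; have N0 := N_gt0.
move=> /andP[x0 x1].
have [[? _]|[x0' _ -> _ _]|[_ _ ->]|[[_ _ -> _ _]|[? _]]] := shrink_cases x; try lra.
  by have := ltr_pM2r x0' d 1; rewrite mul1r => + E; rewrite E ltxx; lra.
have N1 : 1 < N by rewrite -(ltr_pM2r d_gt0) Nd mul1r; lra.
have x1' : 0 < 1 - x by lra.
by have := ltr_pM2r x1' 1 N; rewrite N1 mul1r; lra.
Qed.

End Shrink.

Section FnBasics.
Variables (R : realType) (n : nat).
Hypothesis n2 : (2 <= n)%N.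
Local Notation F := (Fn R n).
Local Notation N := (n%:R : R).
Implicit Types (f g h : F) (x y c d : R).

Lemma FnK f : cancel f (f^-1)%g.
Proof. exact: fnK (fn_prop f). Qed.

Lemma FnVK f : cancel (f^-1)%g f.
Proof. exact: ginvK (fn_prop f). Qed.

Lemma Fn_leE f : {mono f : x y / x <= y}.
Proof. exact: Fn_le (fn_prop f). Qed.

Lemma Fn_ltE f : {mono f : x y / x < y}.
Proof. exact/leW_mono/Fn_leE. Qed.

Lemma Fn_0 f : f 0 = 0.
Proof. exact: Fn_fix0 (fn_prop f). Qed.

Lemma Fn_1 f : f 1 = 1.
Proof. exact: Fn_fix1 (fn_prop f). Qed.

Lemma Fn_out f x : ~~ (0 <= x <= 1) -> f x = x.
Proof. by have [_ _ + _] := fn_prop f; apply. Qed.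

Lemma Fn_conjE f g x : (f ^ g)%g x = g (f (g^-1 x))%g.
Proof. by []. Qed.

(** The infimum of an orbit of a subgroup is a common fixed point. *)
Lemma orbit_inf (L : set F) x : is_subgroup L -> 0 <= x ->
  exists t, [/\ 0 <= t <= x, (forall h, L h -> h t = t) &
    forall e, t < e -> exists2 h, L h & h x < e].
Proof.
move=> [L1 LM LV] x0; pose S := [set h x | h in L].
have S0 : S !=set0 by exists x, 1%g.
have lb0 : lbound S 0 by move=> _ [h _ <-]; rewrite -(Fn_0 h) Fn_leE.
have hlb : has_lbound S by exists 0.
have tle y : S y -> inf S <= y by move=> Sy; apply: ge_inf.
have le1 h : L h -> (h^-1)%g (inf S) <= inf S.
  move=> Lh; apply: lb_le_inf => // _ [k Lk <-].
  rewrite -(Fn_leE h) FnVK; apply: tle; exists (k * h)%g => //.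
  exact: LM.
exists (inf S); split.
- by rewrite lb_le_inf //= tle //; exists 1%g.
- move=> h Lh; apply/eqP; rewrite eq_le.
  have := le1 _ (LV _ Lh); rewrite invgK => -> /=.
  by rewrite -[leLHS](FnVK h) Fn_leE le1.
- move=> e te; have eS : 0 < e - inf S by rewrite subr_gt0.
  have [_ [h Lh <-] he] := inf_adherent eS (conj S0 hlb).
  by exists h => //; move: he; rewrite addrC subrK.
Qed.

Definition fixes_below f c : Prop := forall x, x <= c -> f x = x.
Definition fixes_above f c : Prop := forall x, c <= x -> f x = x.

Lemma fixes_belowW f c d : d <= c -> fixes_below f c -> fixes_below f d.
Proof. by move=> dc fc x /le_trans/(_ dc); apply: fc. Qed.

Lemma fixes_belowV f c : fixes_below f c -> fixes_below (f^-1)%g c.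
Proof. by move=> fc x /fc {1}<-; rewrite FnK. Qed.

Lemma fixes_aboveV f c : fixes_above f c -> fixes_above (f^-1)%g c.
Proof. by move=> fc x /fc {1}<-; rewrite FnK. Qed.

Lemma fixes_aboveJ f g c : fixes_above f c -> fixes_above (f ^ g)%g (g c).
Proof.
by move=> fc x gx; rewrite Fn_conjE fc ?FnVK // -(Fn_leE g) FnVK.
Qed.

Lemma fixes_belowJ f g c : fixes_below f c -> fixes_below (f ^ g)%g (g c).
Proof.
by move=> fc x gx; rewrite Fn_conjE fc ?FnVK // -(Fn_leE g) FnVK.
Qed.

Lemma commute_disjoint f g c :
  fixes_above f c -> fixes_below g c -> commute g f.
Proof.
move=> fc gc; apply: Fn_ext => x; rewrite !FnM.
have [xc|/ltW cx] := leP x c.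
  by rewrite gc // gc // -(fc c) ?Fn_leE.
by rewrite (fc x) // fc // -(gc c) ?Fn_leE.
Qed.

Let N2 : 2 <= N.
Proof. by rewrite ler_nat. Qed.

Let N_gt0 : 0 < N. Proof. by rewrite ltr0n; lia. Qed.

Let d_gt0 : 0 < N^-1. Proof. by rewrite invr_gt0. Qed.

Let d_le : N^-1 <= 1 / 2.
Proof. by rewrite div1r lef_pV2 ?posrE //; lra. Qed.

Let Nd : N * N^-1 = 1. Proof. by rewrite mulfV // gt_eqF. Qed.

Lemma shrink_subproof : is_Fn n (shrink_fun N N^-1).
Proof.
split.
- exact: shrink_homo.
- exact: shrink_surj.
- exact: shrink_out.
have nd : nadic n N^-1 by exists 1, 1%N; rewrite expr1 div1r.
have ne : nadic n (N^-1 * N^-1) by exists 1, 2%N; rewrite expr2 div1r invfM.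
exists [:: N^-1; 1 - N^-1 * N^-1].
  move=> b; rewrite !inE => /orP[] /eqP -> //.
  by apply: nadicD; [exact: nadic1|exact: nadicN].
move=> x y x0 xy y1 sep.
have sd : ~~ (x < N^-1 < y) by apply: sep; rewrite inE eqxx.
have se : ~~ (x < 1 - N^-1 * N^-1 < y) by apply: sep; rewrite !inE eqxx orbT.
have [yd|dy] := leP y N^-1.
  exists (-1) => z /andP[xz zy]; have z0 := le_trans x0 xz.
  rewrite !shrink_piece0 ?(le_trans _ yd) ?(ltW xy) // -exprN1; ring.
have dx : N^-1 <= x by move: sd; rewrite dy andbT -leNgt.
have [ye|ey] := leP y (1 - N^-1 * N^-1).
  exists 0 => z /andP[xz zy]; have dz := le_trans dx xz.
  by rewrite !shrink_piece1 ?(le_trans _ ye) ?(ltW xy) // expr0z; ring.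
have ex : 1 - N^-1 * N^-1 <= x by move: se; rewrite ey andbT -leNgt.
exists 1 => z /andP[xz zy]; have ez := le_trans ex xz.
by rewrite !shrink_piece2 ?(le_trans _ y1) ?(ltW xy) // expr1z; ring.
Qed.

Definition shrink : F := MkFn shrink_subproof.

Lemma shrink_fix x : 0 <= x < 1 -> shrink x = x -> x = 0.
Proof. exact: shrink_fun_fix. Qed.

(** The infimum of the orbit of [x] under the whole group is a fixed point in
    [0,1), hence 0. *)
Lemma Fn_push x c : 0 <= x < 1 -> 0 < c -> exists f, f x < c.
Proof.
move=> /andP[x0 x1] c0.
have [||t [/andP[t0 tx] tF tP]] := @orbit_inf setT x; first by split.
  by [].
have t_0 : t = 0 by apply: shrink_fix; [lra|exact: tF].
by have [|f _ fx] := tP c; [rewrite t_0|exists f].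
Qed.

(** Near 0 an element is linear, which reduces the limits that define the
    characters to constants. *)
Lemma germ0 f : exists (k : int) (d : R), [/\ 0 < d, d <= 1 &
  forall x, 0 <= x <= d -> f x = N ^ k * x].
Proof.
have [_ _ _ [B _ Bf]] := fn_prop f.
have [d [d0 d1 sep]] : exists d : R, [/\ 0 < d, d <= 1 &
    forall c, c \in B -> ~~ (0 < c < d)].
  elim: B {Bf} => [|b B [d [d0 d1 sep]]]; first by exists 1.
  have [bb|bb] := boolP (0 < b < d).
    exists b; split; [lra|lra|] => c; rewrite inE => /predU1P[->|/sep].
      by rewrite ltxx andbF.
    by apply: contra; lra.
  by exists d; split => // c; rewrite inE => /predU1P[->|/sep].
have [k kE] := Bf 0 d (lexx _) d0 d1 sep.
exists k, d; split=> // x xd.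
by rewrite kE // Fn_0 add0r subr0.
Qed.

Lemma ln_expz (k : int) : ln (N ^ k) / ln N = k%:~R.
Proof.
have lnN : ln N != 0 by rewrite gt_eqF // ln_gt0 //; have := N2; lra.
case: k => k; first by rewrite -exprnP lnXn // mulrnAl mulfV.
rewrite NegzE -exprnN lnV ?posrE ?exprn_gt0 // lnXn //.
by rewrite mulNr mulrnAl mulfV.
Qed.

Lemma chi0_germ f (k : int) d : 0 < d ->
  (forall x, 0 <= x <= d -> f x = N ^ k * x) -> chi0 f = k%:~R.
Proof.
move=> d0 fE; rewrite /chi0 -(ln_expz k); congr (ln _ / _).
apply: cvg_lim => //; apply: cvg_near_cst; near=> h.
have h0 : 0 < h by near: h; exact: nbhs_right_gt.
have hd : h <= d by near: h; exact: nbhs_right_le.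
by rewrite Fn_0 subr0 fE ?(ltW h0) // mulfK // gt_eqF.
Unshelve. all: by end_near.
Qed.

Lemma chi1_germ f (k : int) d : 0 < d ->
  (forall x, 0 <= x <= d -> f (1 - x) = 1 - N ^ k * x) -> chi1 f = k%:~R.
Proof.
move=> d0 fE; rewrite /chi1 -(ln_expz k); congr (ln _ / _).
apply: cvg_lim => //; apply: cvg_near_cst; near=> h.
have h0 : h < 0 by near: h; exact: nbhs_left_lt.
have hd : - d <= h by near: h; apply: nbhs_left_ge; rewrite oppr_lt0.
rewrite Fn_1 -{1}(opprK h) fE; last by lra.
by rewrite mulrN opprK addrAC subrr add0r mulfK // lt_eqF.
Unshelve. all: by end_near.
Qed.

Lemma chi0M f g : chi0 (f * g)%g = chi0 f + chi0 g.
Proof.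
have [k [d [d0 _ fE]]] := germ0 f; have [j [e [e0 _ gE]]] := germ0 g.
rewrite (chi0_germ d0 fE) (chi0_germ e0 gE) -intrD.
have Nk : 0 < N ^ k by rewrite exprz_gt0.
apply: (@chi0_germ _ _ (Num.min d (e / N ^ k))).
  by rewrite lt_min d0 divr_gt0.
move=> x; rewrite le_min ler_pdivlMr // => /and3P[x0 xd xe].
rewrite FnM fE ?x0 // gE; last by rewrite mulr_ge0 ?(ltW Nk) //= mulrC.
by rewrite mulrA -expfzDr ?gt_eqF // addrC.
Qed.

Lemma chi01 : chi0 (1%g : F) = 0.
Proof. by have := chi0M 1%g 1%g; rewrite mulg1; lra. Qed.

Lemma chi0V f : chi0 (f^-1)%g = - chi0 f.
Proof. by have := chi0M f f^-1%g; rewrite mulgV chi01; lra. Qed.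

Lemma chi0_commutator f : commutator_subgroup f -> chi0 f = 0.
Proof.
move=> cf; apply: (cf [set f | chi0 f = 0]).
  split=> /= [|x y xE yE|x xE]; rewrite ?chi01 // ?chi0M ?chi0V ?xE ?yE; lra.
by move=> _ [x [y ->]] /=; rewrite commgEl conjgE !chi0M !chi0V; lra.
Qed.

Lemma FnflipM : {morph @Fn_flip R n : f g / (f * g)%g}.
Proof. by move=> f g; apply: Fn_ext => x; rewrite /= subKr. Qed.

Lemma FnflipK : involutive (@Fn_flip R n).
Proof. by move=> f; apply: Fn_ext => x; rewrite /= !subKr. Qed.

Lemma FnflipV f : Fn_flip (f^-1)%g = ((Fn_flip f)^-1)%g.
Proof.
apply: (mulgI (Fn_flip f)); rewrite -FnflipM !mulgV.
by apply: Fn_ext => x /=; rewrite subKr.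
Qed.

Lemma chi1_flip f : chi1 f = chi0 (Fn_flip f).
Proof.
have [k [d [d0 _ fE]]] := germ0 (Fn_flip f).
rewrite (chi0_germ d0 fE); apply: (chi1_germ d0) => x xd.
by rewrite -fE //= subKr.
Qed.

Lemma chi0_flip f : chi0 f = chi1 (Fn_flip f).
Proof. by rewrite chi1_flip FnflipK. Qed.

Lemma chi0_eq0 f : chi0 f = 0 -> exists2 c, 0 < c & fixes_below f c.
Proof.
have [k [d [d0 d1 fE]]] := germ0 f; rewrite (chi0_germ d0 fE) => /eqP.
rewrite intr_eq0 => /eqP k0; exists d => // x xd.
have [x0|x0] := leP 0 x; first by rewrite fE ?x0 // k0 expr0z mul1r.
by apply: Fn_out; rewrite leNgt x0.
Qed.

Lemma chi1_eq0 f : chi1 f = 0 -> exists2 c, c < 1 & fixes_above f c.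
Proof.
rewrite chi1_flip => /chi0_eq0[c c0 fc]; exists (1 - c); first by lra.
move=> x cx; have xc : 1 - x <= c by lra.
by have := fc _ xc; rewrite /= subKr; lra.
Qed.

Lemma fixes_below_chi0 f c : 0 < c -> fixes_below f c -> chi0 f = 0.
Proof.
move=> c0 fc; rewrite (@chi0_germ f 0 c) // => x /andP[_ xc].
by rewrite fc // expr0z mul1r.
Qed.

Lemma fixes_above_chi1 f c : c < 1 -> fixes_above f c -> chi1 f = 0.
Proof.
move=> c1 fc; rewrite (@chi1_germ f 0 (1 - c)) ?subr_gt0 // => x /andP[_ xc].
by rewrite fc ?expr0z ?mul1r //; lra.
Qed.

Lemma chi1M f g : chi1 (f * g)%g = chi1 f + chi1 g.
Proof. by rewrite !chi1_flip FnflipM chi0M. Qed.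

Lemma chi1V f : chi1 (f^-1)%g = - chi1 f.
Proof. by rewrite !chi1_flip FnflipV chi0V. Qed.

End FnBasics.

(** * Actions of F_n on trees with a fixed end *)

Lemma generated_subgroup (G : groupType) (S : set G) : is_subgroup (generated S).
Proof.
split=> [L [L1 _ _] _|x y xS yS L LS SL|x xS L LS SL] //.
  by case: (LS) => _ LM _; apply: LM; [exact: xS|exact: yS].
by case: (LS) => _ _ LV; apply: LV; exact: xS.
Qed.

Lemma generated_sub (G : groupType) (S : set G) : S `<=` generated S.
Proof. by move=> x Sx L _; apply. Qed.

Lemma commutator_subgroupJ (G : groupType) (f g : G) :
  commutator_subgroup f -> commutator_subgroup (f ^ g)%g.
Proof.
have [_ GM _] := generated_subgroup [set x : G | exists y z : G, x = [~ y, z]%g].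
move=> Gf; rewrite -[(f ^ g)%g](mulVKg f) -commgEl.
by apply: GM => //; apply: generated_sub; exists f, g.
Qed.

Section FnTree.
Variables (R : realType) (n : nat).
Hypothesis n2 : (2 <= n)%N.
Local Notation F := (Fn R n).
Local Notation F' := (@commutator_subgroup F).
Variables (T : ggraph F) (up : T -> T) (height : T -> int) (shift : F -> int).
Hypothesis H : fixed_end up height shift.
Hypothesis no_line : no_invariant_axis up shift.
Let conn := fixed_end_connected H.
Implicit Types (f g h z : F) (v w : T).

(** Conjugating [g] by an element [f] that pushes its support off that of [g']
    makes the two commute, so that they have the same axis. If both [f] and
    [h * f] push far enough, [h] preserves the axis of [g]. *)
Lemma disjoint_supports_shift g g' (c d : R) : d < 1 -> 0 < c ->
  fixes_above g d -> fixes_below g' c -> shift g <> 0 -> shift g' <> 0 -> False.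
Proof.
move=> d1 c0.
wlog g0 : g / 0 < shift g.
  move=> W gd g'c /eqP gN; have [g0|g0] := ltP 0 (shift g).
    by apply: W gd g'c _ => //; apply/eqP.
  by apply: (W g^-1%g); rewrite ?(shiftV H) //; [lia|exact: fixes_aboveV|lia].
wlog g'0 : g' / 0 < shift g'.
  move=> W gd g'c gN /eqP g'N; have [g'0|g'0] := ltP 0 (shift g').
    by apply: W gd g'c gN _ => //; apply/eqP.
  by apply: (W g'^-1%g) => //; rewrite ?(shiftV H) //; [lia|exact: fixes_belowV|lia].
move=> gd g'c _ _; apply: (no_line g0) => h u gu.
pose x := Num.max 0 (Num.max d (h d)).
have x01 : 0 <= x < 1.
  by rewrite le_max lexx /= !gt_max ltr01 d1 -(Fn_1 h) Fn_ltE.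
have [f fx] := Fn_push n2 x01 c0.
have com (k : F) : k d <= x -> commute g' (g ^ (k * f))%g.
  move=> kx; apply: (@commute_disjoint _ _ _ _ c) => // y cy.
  apply: (fixes_aboveJ gd); apply: le_trans cy.
  by rewrite FnM (le_trans _ (ltW fx)) // Fn_leE.
have g'u : axis up shift g' (vact f^-1%g u).
  apply: (axis_eq H (g := (g ^ (1 * f))%g)) => //; first by rewrite (shiftJ H).
    by apply: com; rewrite Fn1 /x !le_max lexx !orbT.
  by apply/(axisJ H); rewrite mul1g vactVK.
have hx : h d <= x by rewrite /x !le_max lexx !orbT.
have : axis up shift (g ^ (h * f))%g (vact f^-1%g u).
  by apply: (axis_eq H g'0 _ _ g'u); rewrite ?(shiftJ H) //; exact/commute_sym/com.
by move=> /(axisJ H); rewrite vactM vactVK.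
Qed.

(** Such an element has its support in some [c, d] with 0 < c and d < 1, so the
    previous lemma applies to it and itself. *)
Lemma germ_trivial_shift g : chi0 g = 0 -> chi1 g = 0 -> shift g = 0.
Proof.
move=> /(chi0_eq0 n2)[c c0 gc] /(chi1_eq0 n2)[d d1 gd].
by apply/eqP; apply: contraT => /eqP gN; case: (disjoint_supports_shift d1 c0 gd gc).
Qed.

Variables (a : nat -> F) (l r : nat -> R).
Hypothesis ha : standard_elements a l r.
Local Notation a0 := (a 0%N).
Local Notation r0 := (r 0%N).

Lemma std_fix i x : (i < n)%N -> ~~ (l i < x < r i) -> a i x = x.
Proof.
move=> i_n xN; have [/(_ i i_n)[_ aE] _ _ _ _] := ha.
apply/eqP; apply: contraNT xN => ax.
by have : [set x | a i x != x] x by []; rewrite aE.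
Qed.

Lemma std_below i : (i < n)%N -> fixes_below (a i) (l i).
Proof. by move=> i_n x xl; apply: std_fix => //; rewrite ltNge xl. Qed.

Lemma std_above i : (i < n)%N -> fixes_above (a i) (r i).
Proof. by move=> i_n x xl; apply: std_fix => //; rewrite andbC ltNge xl. Qed.

Lemma std_order i j : (i < j)%N -> (j < n)%N -> r i < l j.
Proof.
have [lr _ _ rl _] := ha.
elim: j => // j IH; rewrite ltnS leq_eqVlt => /predU1P[->|ij] jn.
  by have := rl j.+1; rewrite /= jn => /(_ isT).
have := rl j.+1; rewrite /= jn => /(_ isT); apply: lt_trans.
by rewrite (lt_trans (IH ij _)) ?(ltnW jn) //; have [] := lr j (ltnW jn).
Qed.

Let n_gt0 : (0 < n)%N. Proof. by lia. Qed.

Lemma std_l0 : l 0%N = 0. Proof. by have [_ []] := ha. Qed.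

Lemma std_chi0 : chi0 a0 = 1. Proof. by have [_ []] := ha. Qed.

Lemma std_r0_gt0 : 0 < r0.
Proof. by have [/(_ _ n_gt0)[+ _] _ _ _ _] := ha; rewrite std_l0. Qed.

Lemma std_l_gt0 i : (0 < i)%N -> (i < n)%N -> 0 < l i.
Proof. by move=> i0 i_n; apply: lt_trans std_r0_gt0 (std_order i0 i_n). Qed.

Lemma std_r_lt1 i : (i < n.-1)%N -> r i < 1.
Proof.
move=> i_n; have [lr _ [<- _] _ _] := ha; have n1 : (n.-1 < n)%N by lia.
by apply: lt_trans (std_order i_n n1) _; have [] := lr _ n1.
Qed.

Lemma std_chi0_eq0 i : (0 < i)%N -> (i < n)%N -> chi0 (a i) = 0.
Proof. by move=> i0 i_n; apply: (fixes_below_chi0 n2 (std_l_gt0 i0 i_n) (std_below i_n)). Qed.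

Lemma Zn_ind (P : set F) : is_subgroup P -> (forall i, (i < n)%N -> P (a i)) ->
  forall z, Zn a z -> P z.
Proof. by move=> Psub Pa z zZ; apply: zZ => // _ [i i_n ->]; apply: Pa. Qed.

Lemma Zn_subgroup : is_subgroup (Zn a).
Proof. exact: generated_subgroup. Qed.

Lemma Zn_std i : (i < n)%N -> Zn a (a i).
Proof. by move=> i_n; apply: generated_sub; exists i. Qed.

Lemma Zn_a0X k : Zn a (a0 ^+ k)%g.
Proof.
have [Z1 ZM _] := Zn_subgroup.
by elim: k => [|k IH]; [rewrite expg0|rewrite expgS; apply: ZM => //; apply: Zn_std].
Qed.

Lemma Zn_decomposition g : exists z f, [/\ Zn a z, F' f & g = (z * f)%g].
Proof.
have [_ _ _ _ /(_ g)[z zZ zg]] := ha.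
by exists z, (z^-1 * g)%g; rewrite mulVKg.
Qed.

Lemma Zn_commute z : Zn a z -> commute z a0.
Proof.
apply: (Zn_ind (P := [set z | commute z a0])).
  split=> [|x y xa ya|x xa] /=; rewrite /commute ?mul1g ?mulg1 //.
    exact/commute_sym/commuteM/commute_sym.
  exact/commute_sym/commuteV/commute_sym.
move=> [|i] i_n //; apply: (@commute_disjoint _ _ _ _ r0).
  exact: std_above.
by apply: fixes_belowW (std_below i_n); apply/ltW/std_order.
Qed.

Lemma Zn_fix_r0 z : Zn a z -> z r0 = r0.
Proof.
apply: (Zn_ind (P := [set z | z r0 = r0])).
  split=> [|x y xa ya|x xa] //=.
    by rewrite -[LHS]/(y (x r0)) xa.
  by rewrite -{1}xa -[LHS]/((x^-1)%g (x r0)) FnK.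
move=> [|i] i_n /=; first exact: std_above.
by apply: std_below => //; apply/ltW/std_order.
Qed.

(** The factor of [f] in [Zn] fixes [r0], so only the factor in [F'] matters. *)
Lemma commutator_push e : 0 < e -> exists2 f, F' f & f r0 < e.
Proof.
move=> e0; have [|f fe] := @Fn_push _ _ n2 r0 e _ e0.
  by rewrite (ltW std_r0_gt0) std_r_lt1 //; lia.
have [z [f' [zZ f'F fE]]] := Zn_decomposition f.
by exists f' => //; move: fe; rewrite fE FnM Zn_fix_r0.
Qed.

Lemma Zn_dvd z : Zn a z -> (forall i, (0 < i < n)%N -> shift (a i) = 0) ->
  (shift z)%:~R = (shift a0)%:~R * chi0 z.
Proof.
move=> zZ aN; move: z zZ.
apply: (Zn_ind (P := [set z | (shift z)%:~R = (shift a0)%:~R * chi0 z])).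
  split=> [|x y xa ya|x xa] /=.
  - by rewrite (shift1 H) chi01 ?mulr0.
  - by rewrite (shiftM H) chi0M // intrD xa ya mulrDr.
  - by rewrite (shiftV H) chi0V // intrN xa mulrN.
move=> [|i] i_n /=; first by rewrite std_chi0 mulr1.
by rewrite aN // std_chi0_eq0 // mulr0.
Qed.

Section Axis.
Variable s : F.
Hypothesis s_gt0 : 0 < shift s.
Hypothesis sZ : forall z, Zn a z -> commute z s.

(** [F'] together with [Zn] generates everything, and [Zn] preserves the axis of
    [s]; so if [F'] fixed this axis, the axis would be invariant. *)
Lemma commutator_fix_axis :
  (forall f w, F' f -> axis up shift s w -> vact f w = w) -> False.
Proof.
move=> fixA; apply: (no_line s_gt0) => h w sw.
have [z [f [zZ fF ->]]] := Zn_decomposition h.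
by rewrite vactM (fixA f) //; apply: (axis_commute_act H) => //; apply: sZ.
Qed.

(** [F'] is normal, so fixing one point of the axis it fixes all translates of that
    point by powers of [s]. *)
Lemma commutator_fix_point v : axis up shift s v ->
  (forall f, F' f -> vact f v = v) -> False.
Proof.
move=> sv fixv; apply: commutator_fix_axis => f w fF.
apply: (fix_axis H s_gt0 sv) => k.
by apply/fixJ/fixv; exact: commutator_subgroupJ.
Qed.

(** Elements of [F'] that are trivial near 0 commute with a conjugate of [s],
    by an element of the stabilizer of [v]. *)
Lemma fix_of_push v f f' c : fixes_above s r0 -> axis up shift s v -> F' f ->
  vact f v = v -> F' f' -> f r0 <= c -> fixes_below f' c -> vact f' v = v.
Proof.
move=> sr sv fF fv f'F fc f'c.
apply: (fix_commute_conj H s_gt0 sv fv (shift_commutator H f'F)).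
apply: (@commute_disjoint _ _ _ _ c) => // x cx.
by apply: (fixes_aboveJ sr); apply: le_trans cx.
Qed.

End Axis.

Hypothesis a0N : shift a0 <> 0.

Lemma shift_std i : (0 < i < n)%N -> shift (a i) = 0.
Proof.
move=> /andP[i0 i_n]; apply/eqP; apply: contraT => /eqP aiN.
have r1 : r0 < 1 by apply: std_r_lt1; lia.
case: (disjoint_supports_shift r1 (std_l_gt0 i0 i_n)
  (std_above n_gt0) (std_below i_n) a0N aiN).
Qed.

(** Otherwise each element of [F'] would fix the whole axis: the elements trivial
    on a given [0, e] fix a common point [v] of it, and conjugation by [a0], which
    expands near 0, keeps them trivial there, so they also fix the points
    [a0^m v], which go down the axis. *)
Lemma shift_a0_gt0 : 0 < shift a0.
Proof.
have [//|a0_le] := ltP 0 (shift a0); exfalso.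
pose s := (a0^-1)%g.
have s0 : 0 < shift s by rewrite (shiftV H); lia.
have sZ z : Zn a z -> commute z s by move=> zZ; exact/commuteV/Zn_commute.
have sr : fixes_above s r0 by apply/fixes_aboveV/std_above.
apply: (commutator_fix_axis s0 sZ) => f w fF sw.
have [c c0 fc] := chi0_eq0 n2 (chi0_commutator n2 fF).
have [k [d [d0 d1 aE]]] := germ0 a0.
have k1 : k = 1.
  by apply/eqP; rewrite -(eqr_int R) -(chi0_germ n2 d0 aE) std_chi0.
(* [f] is trivial below [e], and [a0] moves [e] up *)
pose e := Num.min c d; have e0 : 0 < e by rewrite lt_min c0.
have ae : e <= a0 e.
  have ed : e <= d by rewrite ge_min lexx orbT.
  rewrite aE ?(ltW e0) // k1 expr1z.
  by apply: (ler_peMl (ltW e0)); rewrite ler1n; lia.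
have aXe m : e <= (a0 ^+ m)%g e.
  elim: m => [|m IH]; first by rewrite expg0.
  by rewrite expgS FnM (le_trans IH) // Fn_leE.
(* [f1] fixes a point [v] of the axis, and so does every element of [F'] that is
   trivial below [e], in particular the conjugates of [f] by powers of [a0] *)
have [f1 f1F f1e] := commutator_push e0.
have [i f1v] := shift0_fix H w (shift_commutator H f1F).
set v := iter i up w in f1v.
have sv : axis up shift s v by apply: (axis_up H).
apply: (fix_axis H s0 sv) => // m.
apply/fixJ; rewrite /s expVgn invgK.
apply: (fix_of_push s0 sr sv f1F f1v _ (ltW f1e)).
  exact: commutator_subgroupJ.
apply: fixes_belowW (aXe m) _; apply: fixes_belowJ.
by apply: fixes_belowW fc; rewrite ge_min lexx.
Qed.

Lemma shift_chi0 z : Zn a z -> (shift z)%:~R = (shift a0)%:~R * chi0 z.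
Proof. by move=> zZ; apply: Zn_dvd => //; exact: shift_std. Qed.

Lemma shift_dvd g : exists k : int, shift g = k * shift a0.
Proof.
have [z [f [zZ fF ->]]] := Zn_decomposition g.
rewrite (shiftM H) (shift_commutator H fF) addr0.
move: z zZ; apply: (Zn_ind (P := [set z | exists k : int, shift z = k * shift a0])).
  split=> [|x y [k xk] [m ym]|x [k xk]] /=.
  - by exists 0; rewrite (shift1 H) mul0r.
  - by exists (k + m); rewrite (shiftM H) xk ym mulrDl.
  - by exists (- k); rewrite (shiftV H) xk mulNr.
move=> [|i] i_n /=; first by exists 1; rewrite mul1r.
by exists 0; rewrite shift_std ?mul0r.
Qed.

Let c0 := shift_a0_gt0.
Variable v : T.
Hypothesis av : axis up shift a0 v.

(** The confining subset attached to a point of the axis of [a0]. *)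
Definition point_fixator : set F := [set q | F' q /\ vact q v = v].
Local Notation Q := point_fixator.

Lemma point_fixator_subgroup : is_subgroup Q.
Proof.
have [F1 FM FV] : is_subgroup F' by exact: generated_subgroup.
split=> [|x y [xF xv] [yF yv]|x [xF xv]]; split.
- exact: F1.
- exact: vact1.
- exact: FM.
- exact: fixM.
- exact: FV.
- exact: fixV.
Qed.

Lemma point_fixatorX f : F' f -> exists k, Q (f ^ (a0 ^+ k))%g.
Proof.
move=> fF; have [i fi] := shift0_fix H v (shift_commutator H fF).
exists i; split; first exact: commutator_subgroupJ.
apply/fixJ; rewrite (axisX H _ av).
have ik : (i <= i * `|shift a0|)%N by rewrite leq_pmulr //; lia.
by rewrite -(subnK ik) iterD (fix_up H).
Qed.

Lemma point_fixator_confining : confining a Q.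
Proof.
have [Q1 QM QV] := point_fixator_subgroup.
split.
- by move=> q [].
- apply/seteqP; split=> [_ [q qQ <-]|q qQ]; first exact: QV.
  by exists q^-1%g; [exact: QV|rewrite invgK].
- move=> z zZ z0 _ [q [qF qv] <-]; split; first exact: commutator_subgroupJ.
  apply/fixJ; have za := Zn_commute zZ.
  have zv := axis_commute_act H za av.
  have sz0 : 0 <= shift z.
    by rewrite -(ler0z R) shift_chi0 // mulr_ge0 // ler0z ltW.
  rewrite (axis_height H c0 av zv); first exact: (fix_up H).
  by rewrite (height_act H) lerDl.
- move=> h hF; have [k kQ] := point_fixatorX hF.
  by exists (a0 ^+ k)%g => //; exact: Zn_a0X.
- exists 1%g; first by case: Zn_subgroup.
  by move=> p q pQ qQ; rewrite conjg1; exact: QM.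
Qed.

(** Otherwise the set would be invariant under conjugation by all powers of [a0],
    and, as it absorbs [F'] under conjugation by positive powers, [F'] would fix
    the axis. *)
Lemma point_fixator_strict : strictly_confining a Q.
Proof.
have [Q1 QM QV] := point_fixator_subgroup.
split; first exact: point_fixator_confining.
exists a0; first exact: Zn_std.
split.
  have [_ _ QZ _ _] := point_fixator_confining.
  by apply: QZ; rewrite ?std_chi0 ?ler01 //; exact: Zn_std.
move=> Qsub; apply: (commutator_fix_axis c0 Zn_commute) => f w fF aw.
have QX q k : Q q -> Q (q ^ (a0 ^- k))%g.
  elim: k q => [|k IH] q qQ; first by rewrite expg0 invg1 conjg1.
  rewrite expgSr invgM conjgM; apply: IH.
  by have [q' q'Q <-] := Qsub q qQ; rewrite conjgK.
have [k kQ] := point_fixatorX fF.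
rewrite -[f](conjgK (a0 ^+ k)%g); apply/fixJ.
apply: (fix_axis H c0 av); last exact: (axis_actN H).
by move=> m; apply: (fixJ _ _ _).1; have [] := QX _ m kQ.
Qed.

(** The common fixed point is the infimum [t] of the orbit of [r0]. If it were 0,
    then elements of the confining subset would push [r0], hence the support of
    a conjugate of [a0], below the support of any given element of [F'], and
    [F'] would fix [v]. If it were [r0], then [F'], being obtained from the
    confining subset by conjugation with powers of [a0], would fix [r0], as does
    [Zn]; but no point of (0,1) is fixed by all of F_n. *)
Lemma point_fixator_common_fix :
  exists2 t, 0 < t < r0 & forall q, Q q -> q t = t.
Proof.
have [t [/andP[t0 tr] tQ tP]] := orbit_inf point_fixator_subgroup (ltW std_r0_gt0).
have sr : fixes_above a0 r0 by exact: std_above.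
exists t => //; rewrite !lt_neqAle t0 tr !andbT; apply/andP; split; apply/eqP.
  move=> tE; apply: (commutator_fix_point c0 Zn_commute av) => f fF.
  have [c cpos fc] := chi0_eq0 n2 (chi0_commutator n2 fF).
  have [|q [qF qv] qc] := tP c; first by rewrite -tE.
  exact: (fix_of_push c0 sr av qF qv fF (ltW qc)).
move=> tE; have F'r f : F' f -> f r0 = r0.
  move=> fF; have [k kQ] := point_fixatorX fF.
  have := tQ _ kQ; rewrite tE Fn_conjE => fE.
  have aZ : (a0 ^+ k)%g r0 = r0 by exact: (Zn_fix_r0 (Zn_a0X k)).
  have aV : (a0 ^- k)%g r0 = r0 by rewrite -{1}aZ FnK.
  by apply: (can_inj (FnK (a0 ^+ k)%g)); rewrite aZ -{1}aV.
have : r0 = 0.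
  apply: (shrink_fix (n2 := n2)); first by rewrite (ltW std_r0_gt0) std_r_lt1 //; lia.
  have [z [f [zZ fF ->]]] := Zn_decomposition (shrink R n2).
  by rewrite FnM Zn_fix_r0 // F'r.
by have := std_r0_gt0 => /[swap] ->; rewrite ltxx.
Qed.

Local Notation S := (Q `|` Zchi a).
Let C := cayley_graph S.

Lemma cayley_step (g q : C) : S q -> exists2 k,
  walk g (g * q : C)%g k & (k <= 1)%N.
Proof.
move=> qS; have [gE|gN] := eqVneq g (g * q)%g.
  by exists 0 => //; rewrite -gE; exact: walk0.
exists 1%N => //; apply: walk1; rewrite /= /cayley_adj gN /=.
by apply/asboolP; left; rewrite mulKg.
Qed.

Lemma Zchi_a0 : Zchi a a0.
Proof. by split; [exact: Zn_std|rewrite std_chi0 normr1]. Qed.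

Lemma cayley_stepX (g : C) m : exists2 k,
  walk g (g * a0 ^+ m : C)%g k & (k <= m)%N.
Proof.
elim: m => [|m [k gk km]].
  by exists 0 => //; rewrite expg0 mulg1; exact: walk0.
have [j hj j1] := @cayley_step (g * a0 ^+ m)%g a0 (or_intror Zchi_a0).
exists (k + j)%N; last by rewrite -addn1 leq_add.
by apply: walk_cat gk _; rewrite expgSr mulgA.
Qed.

(** Word length is bounded in terms of displacement: in the normal form
    [a0^m k a0^-m'] the elliptic factor [k] is a product of two generators, one
    in [Zn] and one in the confining subset. *)
Lemma cayley_walk (g : C) : exists2 k, walk (1%g : C) g k &
  (k <= 3 * gdist v (vact g v) + 2)%N.
Proof.
have [m [k [m' [kv gE le]]]] := ascending_decomposition H c0 shift_dvd av g.
have [z [f [zZ fF kE]]] := Zn_decomposition k.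
have sz : shift z = 0.
  have := fix_shift H kv; rewrite kE (shiftM H) (shift_commutator H fF).
  by rewrite addr0.
have zv : vact z v = v by apply: (axis_fix H c0 sz) (Zn_commute zZ) av.
have zS : S z.
  right; split=> //; have /eqP := shift_chi0 zZ.
  rewrite sz eq_sym mulf_eq0 intr_eq0 gt_eqF //= => /eqP ->.
  by rewrite normr0 ler01.
have fS : S f.
  left; split=> //; have := kv; rewrite /stabilizer /= kE vactM => zf.
  by apply: (@vact_inj _ _ z); rewrite zf zv.
have [i1 w1 l1] := cayley_stepX (1%g : C) m.
have [i2 w2 l2] := @cayley_step (1 * a0 ^+ m)%g z zS.
have [i3 w3 l3] := @cayley_step (1 * a0 ^+ m * z)%g f fS.
have [i4 w4 l4] := cayley_stepX g m'.
exists (i1 + (i2 + (i3 + i4)))%N; last first.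
  by apply: (@leq_trans (m + m' + 2)); [lia|rewrite leq_add2r].
apply: walk_cat w1 _; apply: walk_cat w2 _; apply: walk_cat w3 _.
apply: walk_sym; rewrite (_ : (1 * _ * z * f)%g = (g * a0 ^+ m')%g) //.
by rewrite mul1g -mulgA -kE gE mulgVK.
Qed.

Lemma cayley_connected : gconnected C.
Proof.
move=> g h; have [k kw _] := cayley_walk (g^-1 * h)%g; exists k.
by have := walk_act g kw; rewrite /= mulg1 mulVKg.
Qed.

Lemma gdist_generator q : S q -> (gdist v (vact q v) <= `|shift a0|)%N.
Proof.
move=> [[_ ->]|[qZ q1]]; first by rewrite gdist0.
rewrite (gdist_axis H c0 av); last exact: (axis_commute_act H (Zn_commute qZ) av).
rewrite (height_act H).
have : `|shift q| <= `|shift a0| :> int.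
  rewrite -(ler_int R) !intr_norm shift_chi0 // normrM ler_piMr //.
by lia.
Qed.

Lemma cayley_walk_gdist k (g h : C) : walk g h k ->
  (gdist (vact g v) (vact h v) <= `|shift a0| * k)%N.
Proof.
elim: k g => [|k IH] g.
  by move=> [[|? ?] [//= _ -> _]]; rewrite gdist0.
move=> /walkS[w gw /IH le].
apply: leq_trans (gdist_triangle conn _ (vact w v) _) _.
rewrite mulnS; apply: leq_add le.
case/andP: gw => _ /asboolP[] /gdist_generator.
  by rewrite -(gdist_act conn g) -vactM mulVKg.
by rewrite -(gdist_act conn w) -vactM mulVKg (gdist_sym conn).
Qed.

Lemma lamplike_equivalent : cobounded (realization R T) ->
  equivalent_actions (realization R T) (lamplike_model a Q).
Proof.
move=> /(cobounded_vertex conn)/(_ v)[D vD]; split.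
  apply: (@dominated_orbit _ _ _ C v (1%g : C) `|shift a0| 0 0).
  - exact: conn.
  - exact: cayley_connected.
  - by move=> g; exists g; rewrite /= mulg1 gdist0.
  - move=> g; have := gdist_walk cayley_connected (1%g : C) g.
    by move=> /cayley_walk_gdist; rewrite vact1 addn0 /= mulg1.
apply: (@dominated_orbit _ _ C _ (1%g : C) v 3 2 D) => //.
- exact: cayley_connected.
- move=> g; rewrite /= mulg1.
  by have [k /gdist_le kw] := cayley_walk g; apply: leq_trans.
Qed.

End FnTree.

(** * Reflecting the interval *)

Section TwistGraph.
Variables (G : groupType) (phi : G -> G).
Hypothesis phiM : {morph phi : x y / (x * y)%g}.
Hypothesis phiK : involutive phi.
Variable T : ggraph G.

Let phi1 : phi 1%g = 1%g.
Proof. by apply: (mulgI (phi 1%g)); rewrite -phiM !mulg1. Qed.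

Let phiV g : phi (g^-1)%g = ((phi g)^-1)%g.
Proof. by apply: (mulgI (phi g)); rewrite -phiM !mulgV phi1. Qed.

Let twist_act1 (v : T) : vact (phi 1%g) v = v.
Proof. by rewrite phi1 vact1. Qed.

Let twist_actM g h (v : T) : vact (phi (g * h)%g) v = vact (phi g) (vact (phi h) v).
Proof. by rewrite phiM vactM. Qed.

(** The realization of this graph is the twisted realization, so that a twisted
    action on a tree is again an action on a tree. *)
Definition twist_graph : ggraph G :=
  GGraph (@adj_irr G T) (@adj_sym G T) twist_act1 twist_actM
    (fun g => vact_adj (phi g)).

Lemma realization_twist (R : realType) :
  realization R twist_graph = twist phi (realization R T).
Proof.
congr GSpace; apply/funext => g; apply/funext => p; apply: eq_exist => /=.
by apply/funext => w; rewrite phiV.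
Qed.

Lemma cobounded_twist (R : realType) :
  cobounded (realization R T) -> cobounded (realization R twist_graph).
Proof.
rewrite realization_twist => -[x0 [C xC]]; exists x0, C => x.
by have [g gC] := xC x; exists (phi g); rewrite /= phiK.
Qed.

Lemma fixed_end_twist (up : T -> T) (height : T -> int) (shift : G -> int) :
    fixed_end up height shift ->
  @fixed_end G twist_graph up height (fun g => shift (phi g)).
Proof.
case=> adj_up edge eq_act hup hact sM meet; split.
- exact: adj_up.
- exact: edge.
- by move=> g v; exact: (eq_act (phi g) v).
- exact: hup.
- by move=> g v; exact: (hact (phi g) v).
- by move=> g h; rewrite phiM sM.
- exact: meet.
Qed.

Lemma no_invariant_axis_twist (up : T -> T) (shift : G -> int) :
    no_invariant_axis up shift ->
  @no_invariant_axis G twist_graph up (fun g => shift (phi g)).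
Proof.
move=> no_line g g0 gP; apply: (no_line (phi g) g0) => h w gw.
by have := gP (phi h) w gw; rewrite /axis /= phiK.
Qed.

End TwistGraph.

Lemma lamplike_of_shift (R : realType) (n : nat) (T : ggraph (Fn R n))
    (up : T -> T) (height : T -> int) (shift : Fn R n -> int)
    (a : nat -> Fn R n) (l r : nat -> R) :
    (2 <= n)%N -> fixed_end up height shift -> no_invariant_axis up shift ->
    standard_elements a l r -> shift (a 0%N) <> 0 ->
    cobounded (realization R T) ->
  exists Q, [/\ strictly_confining a Q,
    (exists2 t : R, 0 < t < r 0%N & forall q, Q q -> q t = t) &
    equivalent_actions (realization R T) (lamplike_model a Q)].
Proof.
move=> n2 H no_line ha a0N cob; have [x0 _] := cob.
have a0_gt0 := shift_a0_gt0 n2 H no_line ha a0N.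
have [k av] := axis_nonempty H (near_vertex x0) a0_gt0.
exists (point_fixator (iter k up (near_vertex x0))); split.
- exact: (point_fixator_strict n2 H no_line ha a0N av).
- exact: (point_fixator_common_fix n2 H no_line ha a0N av).
- exact: (lamplike_equivalent n2 H no_line ha a0N av cob).
Qed.

Theorem theorem4 (R : realType) (n : nat) (hn : (2 <= n)%N)
    (a : nat -> Fn R n) (l r : nat -> R) (ha : standard_elements a l r)
    (T : ggraph (Fn R n)) (hT : is_tree T)
    (hcob : cobounded (realization R T))
    (hqp : quasi_parabolic (realization R T)) :
  lamplike a (r 0%N) (realization R T) /\
  exists (K : set (Fn R n)) (s : Fn R n),
    strictly_ascending_hnn K s /\
    equivalent_actions (realization R T) (realization R (bass_serre_tree K s)).
Proof.
split; last exact: quasi_parabolic_hnn.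
have [up [height [shift H]]] := quasi_parabolic_fixed_end hT hqp.
have no_line := quasi_parabolic_no_axis hT H hqp.
have [a0N|a0Z] := pselect (shift (a 0%N) <> 0).
  have [Q [Qs Qt Qe]] := lamplike_of_shift hn H no_line ha a0N hcob.
  by exists Q; split=> //; left.
have n1 : (n.-1 < n)%N by lia.
have {}a0Z : shift (a 0%N) = 0 by apply: contrapT.
(* the shift cannot vanish on [F'] and on all the generators of [Zn], and by
   disjointness of supports it vanishes on the intermediate ones *)
have anN : shift (a n.-1) <> 0.
  move=> anZ; have [g] := cobounded_shift hT H hcob.
  have [z [f [zZ fF ->]]] := Zn_decomposition ha g.
  rewrite (shiftM H) (shift_commutator H fF) addr0.
  suff -> : shift z = 0 by [].
  move: z zZ; apply: (Zn_ind (P := [set z | shift z = 0])).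
    by split=> [|x y /= xE yE|x /= xE] /=;
      rewrite ?(shift1 H) // ?(shiftM H) ?(shiftV H) ?xE ?yE.
  move=> i i_n /=; have [->//|i0] := eqVneq i 0.
  have [->//|in1] := eqVneq i n.-1.
  apply: contrapT => iN.
  have ri : r i < 1 by apply: (std_r_lt1 hn ha); lia.
  have li : 0 < l i by apply: (std_l_gt0 hn ha) => //; lia.
  exact: (disjoint_supports_shift hn H no_line ri li (std_above ha i_n)
           (std_below ha i_n) iN iN).
(* these two elements have the same germs at 0 and 1 *)
have flipE : shift (Fn_flip (a 0%N)) = shift (a n.-1).
  have : shift (Fn_flip (a 0%N) * (a n.-1)^-1)%g = 0.
    have r0 : r 0%N < 1 by apply: (std_r_lt1 hn ha); lia.
    have [_ [_ chi_0] [_ chi_1] _ _] := ha.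
    apply: (germ_trivial_shift hn H no_line).
      rewrite chi0M // chi0V // -chi1_flip //.
      rewrite (fixes_above_chi1 hn r0) ?(std_chi0_eq0 hn ha) ?subr0 //; first by lia.
      by apply: (std_above ha); lia.
    by rewrite chi1M // chi1V // -chi0_flip // chi_0 chi_1 subrr.
  by rewrite (shiftM H) (shiftV H); lia.
pose T' := twist_graph (@FnflipM R n) T.
have H' := fixed_end_twist (@FnflipM R n) H.
have no_line' := no_invariant_axis_twist (phiM := @FnflipM R n) (@FnflipK R n) no_line.
have [||Q [Qs Qt Qe]] := lamplike_of_shift hn H' no_line' ha.
- by rewrite flipE.
- exact: (cobounded_twist (@FnflipM R n) (@FnflipK R n) hcob).
exists Q; split=> //; right; apply: (equivalent_twist (@FnflipK R n)).
by rewrite realization_twist in Qe.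
Qed.
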